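(* Let $S\subset(\mathbb Z_+^2)^*$ be a generalized tower set. Then $S$ is aCM; that is, for $R=k[x_1,\ldots,x_n]$ ($k$ a field, $n$ at least every integer occurring as a coordinate of an element of $S$), the squarefree monomial ideal $I_S=\bigcap_{(i,j)\in S}(x_i,x_j)$ is such that $R/I_S$ is Cohen-Macaulay.
   Context: $\mathbb Z_+$ is the set of positive integers; $(\mathbb Z_+^2)^*=\{(a,b)\in\mathbb Z_+^2\mid a\neq b\}$; $\pi_1,\pi_2$ are the coordinate projections. For finite $T\subset\mathbb Z_+^2$ and $j\in\mathbb Z_+$ put $T_j=\{i\mid(i,j)\in T\}$. A finite $T\subset\mathbb Z_+^2$ is a tower set if $T_a\supseteq T_b$ whenever $a<b$ and $T_a\ne\emptyset$. For a tower set $T\subset(\mathbb Z_+^2)^*$ and $h\in\pi_1(T)\cap\pi_2(T)$ put $F_T(h):=\{j\in\pi_2(T)\mid T_h\subsetneq T_j\text{ and }(h,j)\notin T\}$. A set $U$ of $2$-element subsets of $\mathbb Z_+$ is connected if for all $A,B\in U$ there is $C\in U$ with $A\cap C\neq\emptyset$ and $B\cap C\ne\emptyset$. A set $S\subset(\mathbb Z_+^2)^*$ is connected if $\{\{a,b\}\mid(a,b)\in S\}$ is connected. A finite set $S\subset(\mathbb Z_+^2)^*$ is a generalized tower set if: (1) $S$ is connected; (2) $S=T\cup S_0$ where $T$ is a tower set, and $S_0$ satisfies: (3) for every $(i,j)\in S_0$, $i\notin\pi_1(T)\cup\pi_2(T)$ and $j\in\pi_1(T)\cap\pi_2(T)$;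 (4) for every $(i,j)\in S_0$ and $h\in F_T(j)$, $(i,h)\in S_0$. *)

(* Defs.v *)
Set Warnings "-redundant-canonical-projection".
From HB Require Import structures.
From mathcomp Require Import all_boot all_order all_algebra.
From mathcomp Require Import finmap mpoly.
From mathcomp Require Import boolp.

Set Implicit Arguments.
Unset Strict Implicit.
Unset Printing Implicit Defensive.

Import GRing.Theory.

Local Open Scope fset_scope.
Local Open Scope ring_scope.

Section CohenMacaulay.

(* [comPzRingType] allows the zero ring, which is (vacuously) Cohen-Macaulay. *)
Variable A : comPzRingType.
Implicit Types (I P M : A -> Prop) (s : seq A) (d : nat).

Definition is_ideal I : Prop :=
  [/\ I 0, forall x y, I x -> I y -> I (x + y)
    & forall a x, I x -> I (a * x)].

Definition prime_ideal P : Prop :=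
  [/\ is_ideal P, ~ P 1 & forall x y, P (x * y) -> P x \/ P y].

Definition maximal_ideal M : Prop :=
  [/\ is_ideal M, ~ M 1
    & forall I, is_ideal I -> ~ I 1 -> (forall x, M x -> I x) ->
      forall x, I x -> M x].

Definition gen_ideal s : A -> Prop :=
  fun x => exists c : nat -> A, x = \sum_(i < size s) c i * s`_i.

Definition noetherian : Prop :=
  forall I, is_ideal I -> exists s, forall x, I x <-> gen_ideal s x.

Definition regular_seq s : Prop :=
  ~ gen_ideal s 1 /\
  forall i, (i < size s)%N -> forall x,
    gen_ideal (take i s) (s`_i * x) -> gen_ideal (take i s) x.

Definition depth_eq P d : Prop :=
  (exists s, [/\ regular_seq s, {in s, forall x, P x} & size s = d]) /\
  (forall s, regular_seq s -> {in s, forall x, P x} -> (size s <= d)%N).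

(* c 0, ..., c d is a strictly increasing chain of primes with c d = P. *)
Definition prime_chain P d (c : nat -> A -> Prop) : Prop :=
  [/\ forall i, (i <= d)%N -> prime_ideal (c i),
      forall i, (i < d)%N ->
        (forall x, c i x -> c i.+1 x) /\ (exists x, c i.+1 x /\ ~ c i x)
    & forall x, c d x <-> P x].

(* codim P = height P = Krull dimension of the localization of A at P. *)
Definition codim_eq P d : Prop :=
  (exists c, prime_chain P d c) /\
  (forall e c, prime_chain P e c -> (e <= d)%N).

(* Eisenbud, Commutative Algebra, Section 18.2: depth(M, A) = codim M for every
   maximal ideal M. As M is maximal, depth(M, A) is the depth of the local ring
   A_M, so this says that each A_M is a Cohen-Macaulay local ring. *)
Definition cohen_macaulay : Prop :=
  noetherian /\
  forall M, maximal_ideal M -> exists d, depth_eq M d /\ codim_eq M d.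

End CohenMacaulay.

Arguments cohen_macaulay A : clear implicits.

Section StanleyReisnerQuotient.

Variables (k : fieldType) (n : nat) (S : {fset nat * nat}).

(* The variable x_i (1 <= i <= n) is 'X_o for the o : 'I_n with o.+1 = i.
   When n bounds all the coordinates occurring in S, this is the intersection
   of the ideals (x_i, x_j) over all (i, j) in S. *)
Definition ideal_of : {pred {mpoly k[n]}} :=
  [pred p | `[< forall i j : 'I_n, (i.+1, j.+1) \in S ->
                  gen_ideal [:: 'X_i; 'X_j] p >]].

Lemma gen_ideal2 (a b p : {mpoly k[n]}) :
  gen_ideal [:: a; b] p <-> exists u v, p = u * a + v * b.
Proof.
split=> [[c ->]|[u [v ->]]].
  by exists (c 0), (c 1); rewrite !big_ord_recl big_ord0 addr0.
exists (fun i => if i is 0 then u else v).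
by rewrite !big_ord_recl big_ord0 addr0.
Qed.

Lemma ideal_of_zmod_closed : zmod_closed ideal_of.
Proof.
split=> [|p q /asboolP Hp /asboolP Hq]; apply/asboolP => i j Sij.
  by apply/gen_ideal2; exists 0, 0; rewrite !mul0r addr0.
have /gen_ideal2[u [v ->]] := Hp _ _ Sij.
have /gen_ideal2[u' [v' ->]] := Hq _ _ Sij.
apply/gen_ideal2; exists (u - u'), (v - v').
by rewrite !mulrBl opprD addrACA.
Qed.

HB.instance Definition _ :=
  GRing.isZmodClosed.Build {mpoly k[n]} ideal_of ideal_of_zmod_closed.

Lemma ideal_ofMl (a p : {mpoly k[n]}) : p \in ideal_of -> a * p \in ideal_of.
Proof.
move=> /asboolP Hp; apply/asboolP => i j Sij.
have /gen_ideal2[u [v ->]] := Hp _ _ Sij.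
by apply/gen_ideal2; exists (a * u), (a * v); rewrite mulrDr !mulrA.
Qed.

(* {ideal_quot _} requires a proper ideal, but I_S = R when S is empty, so the
   ring structure is rebuilt here on the library's quotient Z-module. *)
Definition SR_quot := Quotient.quot (ideal_of : zmodClosed {mpoly k[n]}).

HB.instance Definition _ := GRing.Zmodule.on SR_quot.
HB.instance Definition _ := EqQuotient.on SR_quot.

Local Open Scope quotient_scope.

Definition SR_one : SR_quot := \pi_SR_quot 1.
Definition SR_mul (x y : SR_quot) : SR_quot := \pi_SR_quot (repr x * repr y).

Lemma SR_piP (p q : {mpoly k[n]}) :
  \pi_SR_quot p = \pi_SR_quot q <-> p - q \in ideal_of.
Proof.
by rewrite (Quotient.idealrBE (ideal_of : zmodClosed _)); split=> /eqP.
Qed.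

Lemma SR_piD (p q : {mpoly k[n]}) :
  \pi_SR_quot (p + q) = \pi_SR_quot p + \pi_SR_quot q.
Proof. exact: Quotient.pi_add. Qed.

Lemma SR_piM (p q : {mpoly k[n]}) :
  SR_mul (\pi_SR_quot p) (\pi_SR_quot q) = \pi_SR_quot (p * q).
Proof.
apply/SR_piP; set p' := repr _; set q' := repr _.
have -> : p' * q' - p * q = q' * (p' - p) + p * (q' - q).
  by rewrite !mulrBr (mulrC q' p') (mulrC q' p) addrA (subrK (p * q')).
by apply: rpredD; apply: ideal_ofMl; apply/SR_piP; rewrite reprK.
Qed.

Lemma SR_mulA : associative SR_mul.
Proof.
move=> x y z; rewrite -[x]reprK -[y]reprK -[z]reprK.
by rewrite (SR_piM (repr y) (repr z)) (SR_piM (repr x) (repr y)) !SR_piM mulrA.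
Qed.

Lemma SR_mulC : commutative SR_mul.
Proof. by move=> x y; rewrite /SR_mul mulrC. Qed.

Lemma SR_mul1 : left_id SR_one SR_mul.
Proof. by move=> x; rewrite -[x]reprK SR_piM mul1r. Qed.

Lemma SR_mulD : left_distributive SR_mul +%R.
Proof.
move=> x y z; rewrite -[x]reprK -[y]reprK -[z]reprK.
by rewrite -SR_piD !SR_piM -SR_piD mulrDl.
Qed.

HB.instance Definition _ := GRing.Zmodule_isComPzRing.Build SR_quot
  SR_mulA SR_mulC SR_mul1 SR_mulD.

End StanleyReisnerQuotient.

Definition is_aCM (S : {fset nat * nat}) : Prop :=
  forall (k : fieldType) (n : nat),
    (forall i j : nat, (i, j) \in S -> (i <= n)%N /\ (j <= n)%N) ->
    cohen_macaulay (SR_quot k n S).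

Section TowerSets.

Implicit Types (S T : {fset nat * nat}) (h j : nat).

Definition positive_pairs T : Prop :=
  forall i j : nat, (i, j) \in T -> (0 < i)%N /\ (0 < j)%N.

Definition offdiag_pairs S : Prop :=
  positive_pairs S /\ forall i j : nat, (i, j) \in S -> i != j.

Definition pr1 T : {fset nat} := [fset x.1 | x in T].
Definition pr2 T : {fset nat} := [fset x.2 | x in T].

(* T_j = { i | (i, j) \in T } *)
Definition fiber T j : {fset nat} := [fset x.1 | x in T & x.2 == j].

Definition tower_set T : Prop :=
  positive_pairs T /\
  forall a b, (0 < a)%N -> (a < b)%N -> fiber T a != fset0 ->
    fiber T b `<=` fiber T a.

Definition F_ T h : {fset nat} :=
  [fset j in pr2 T | (fiber T h `<` fiber T j) && ((h, j) \notin T)].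

Definition connected_family (U : {fset {fset nat}}) : Prop :=
  forall A B, A \in U -> B \in U ->
    exists C, [/\ C \in U, A `&` C != fset0 & B `&` C != fset0].

Definition connected_set S : Prop :=
  connected_family [fset [fset x.1; x.2] | x in S].

Definition generalized_tower_set S : Prop :=
  [/\ offdiag_pairs S,
      connected_set S
    & exists T S0 : {fset nat * nat},
      [/\ S = T `|` S0, tower_set T,
          forall i j : nat, (i, j) \in S0 ->
            i \notin pr1 T `|` pr2 T /\ j \in pr1 T `&` pr2 T
        & forall i j h : nat, (i, j) \in S0 -> h \in F_ T j -> (i, h) \in S0]].

End TowerSets.

(* Main.v *)
Require Import Defs.
From HB Require Import structures.
From mathcomp Require Import all_boot all_order all_algebra.
From mathcomp Require Import finmap mpoly boolp zify ring.

(* I_S is the intersection of the primes P_e = (x_i, x_j) over the edges e = ij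
   of a graph.  List the edges of T column by column, and then those of S_0 by
   decreasing column fiber, breaking ties by the number of neighbours of the row
   within the columns of equal fiber.  With this order any two disjoint edges are
   joined by an edge that precedes the later of the two.  Hence, if I' is the
   ideal of the edges before e and f is the product of the vertices outside e
   joined to e by them, then f lies in I', (I' /\ P_e) : f = P_e and
   (I' /\ P_e) + (f) = I'.  So R/I_S is filtered by the rings R/P_e, and a
   sequence that is weakly regular on each R/P_e is so on R/I_S.

   Let M be a maximal ideal.  By Zariski's lemma M contains a monic univariate
   polynomial in each variable, hence one z_i in x_i without constant term.  The
   coefficients of T^2, ..., T^(n-1) in prod_i (T + z_i), i.e. the elementary
   symmetric functions of the z_i of positive degree at most n - 2, lie in M; on
   R/P_e, where z_i = z_j = 0, they are the elementary symmetric functions of the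
   other n - 2 elements z_l, which form a regular sequence.  So the depth of M is
   at least n - 2.  A regular sequence produces a chain of primes of the same
   length ending at M, and no chain over I_S is longer than n - 2, by algebraic
   dependence. *)

Set Implicit Arguments.
Unset Strict Implicit.
Unset Printing Implicit Defensive.
Import Order.TTheory GRing.Theory.
Local Open Scope ring_scope.

(** * Regular sequences and prime chains *)

Section Ideals.
Variable A : comPzRingType.
Implicit Types (I J P : A -> Prop) (a u x y : A) (s : seq A).

Definition adj J a : A -> Prop := fun x => exists b, J (x - b * a).
Definition colon J u : A -> Prop := fun x => J (u * x).

(** Weak regularity on the quotient by [J]: properness of the final ideal is left out, so that the
    notion passes along filtrations, some of whose pieces may vanish. *)
Fixpoint wreg J s : Prop :=
  if s is a :: s' then (forall x, J (a * x) -> J x) /\ wreg (adj J a) s' else True.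

Lemma ideal0 J : is_ideal J -> J 0. Proof. by case. Qed.
Lemma idealD J x y : is_ideal J -> J x -> J y -> J (x + y).
Proof. by case=> _ + _; apply. Qed.
Lemma ideal_mull J a x : is_ideal J -> J x -> J (a * x).
Proof. by case=> _ _; apply. Qed.
Lemma ideal_mulr J a x : is_ideal J -> J x -> J (x * a).
Proof. by rewrite mulrC; apply: ideal_mull. Qed.
Lemma idealN J x : is_ideal J -> J x -> J (- x).
Proof. by move=> iJ; rewrite -mulN1r; apply: ideal_mull. Qed.
Lemma idealB J x y : is_ideal J -> J x -> J y -> J (x - y).
Proof. by move=> iJ Jx Jy; apply: idealD => //; apply: idealN. Qed.
Lemma ideal_subl J x y : is_ideal J -> J (x - y) -> J y -> J x.
Proof. by move=> iJ Jxy Jy; rewrite -(subrK y x); apply: idealD. Qed.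
Lemma ideal_subr J x y : is_ideal J -> J (x - y) -> J x -> J y.
Proof. by move=> iJ Jxy Jx; rewrite -[y](subKr x); apply: idealB. Qed.
Lemma ideal_sum J (K : Type) (r : seq K) (Q : pred K) (F : K -> A) :
  is_ideal J -> (forall i, Q i -> J (F i)) -> J (\sum_(i <- r | Q i) F i).
Proof.
move=> iJ JF; apply: big_ind => //; first exact: ideal0.
by move=> x y; apply: idealD.
Qed.

Lemma ideal_ext I J : (forall x, I x <-> J x) -> I = J.
Proof. by move=> IJ; apply/funext => x; apply/propext. Qed.

Lemma adj_ideal J a : is_ideal J -> is_ideal (adj J a).
Proof.
move=> iJ; split=> [|x y [b Jx] [c Jy]|c x [b Jx]].
- by exists 0; rewrite mul0r subr0; apply: ideal0.
- by exists (b + c); rewrite mulrDl opprD addrACA; apply: idealD.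
- by exists (c * b); rewrite -mulrA -mulrBr; apply: ideal_mull.
Qed.

Lemma sub_adj J a x : J x -> adj J a x.
Proof. by move=> Jx; exists 0; rewrite mul0r subr0. Qed.

Lemma mem_adj J a : is_ideal J -> adj J a a.
Proof. by move=> iJ; exists 1; rewrite mul1r subrr; apply: ideal0. Qed.

Lemma adj_mono I J a x : (forall y, I y -> J y) -> adj I a x -> adj J a x.
Proof. by move=> IJ [b Ix]; exists b; apply: IJ. Qed.

Lemma adj_min J P a x : is_ideal P -> (forall y, J y -> P y) -> P a ->
  adj J a x -> P x.
Proof.
by move=> iP JP Pa [b /JP]; move/(ideal_subl iP); apply; apply: ideal_mull.
Qed.

Lemma adj_congr J a a' : is_ideal J -> J (a - a') -> adj J a = adj J a'.
Proof.
move=> iJ Jaa'; apply: ideal_ext => x; split=> -[b Jx]; exists b.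
  have -> : x - b * a' = (x - b * a) + b * (a - a') by ring.
  by apply: idealD => //; apply: ideal_mull.
have -> : x - b * a = (x - b * a') - b * (a - a') by ring.
by apply: idealB => //; apply: ideal_mull.
Qed.

Lemma adjC J a b : adj (adj J a) b = adj (adj J b) a.
Proof.
by apply: ideal_ext => x; split=> -[c [d Jx]]; exists d, c; rewrite addrAC.
Qed.

Lemma wreg_full J s : J 1 -> is_ideal J -> wreg J s.
Proof.
elim: s J => //= a s IH J J1 iJ; split.
  by move=> x _; rewrite -[x]mulr1; apply: ideal_mull.
by apply: IH; [apply: sub_adj|apply: adj_ideal].
Qed.

(* The cyclic-module case of the fact that regularity on both ends of
   0 -> A/(J : u) -> A/J -> A/(J + (u)) -> 0 passes to the middle. *)
Lemma wreg_colon J u s : is_ideal J ->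
  wreg (colon J u) s -> wreg (adj J u) s -> wreg J s.
Proof.
elim: s J => //= a s IH J iJ [reg1 wreg1] [reg2 wreg2]; split.
  move=> x Jax; have [y Jx] := reg2 x (sub_adj _ Jax).
  have Jy : colon J u y.
    apply: reg1; rewrite /colon; have -> : u * (a * y) = a * x - a * (x - y * u) by ring.
    by apply: idealB => //; apply: ideal_mull.
  by apply: (ideal_subl iJ Jx); rewrite mulrC.
apply: IH; first exact: adj_ideal; last by rewrite adjC.
suff -> : colon (adj J a) u = adj (colon J u) a by [].
apply: ideal_ext => y; rewrite /colon; split=> -[t Jt].
  have [w Jw] : adj J u t.
    apply: reg2; exists y; have -> : a * t - y * u = - (u * y - t * a) by ring.
    exact: idealN.
  exists w; have -> : u * (y - w * a) = (u * y - t * a) + a * (t - w * u) by ring.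
  by apply: idealD => //; apply: ideal_mull.
by exists (u * t); rewrite -mulrA -mulrBr.
Qed.

(** Let w be the product without z_i. Regularity of z_i modulo J gives (J, z_i w) : z_i = (J, w),
    while adding z_i to (J, z_i w) gives (J, z_i); so [wreg_colon] splits off one factor at a
    time. *)
Lemma wreg_prod J (K : eqType) (r : seq K) (z : K -> A) s : is_ideal J ->
  (forall i, i \in r -> forall x, J (z i * x) -> J x) ->
  (forall i, i \in r -> wreg (adj J (z i)) s) ->
  wreg (adj J (\prod_(i <- r) z i)) s.
Proof.
move=> iJ; elim: r => [|i r IH] regz wregz.
  by rewrite big_nil; apply: wreg_full; [apply: mem_adj|apply: adj_ideal].
rewrite big_cons; apply: (@wreg_colon _ (z i)); first exact: adj_ideal.
  suff -> : colon (adj J (z i * \prod_(j <- r) z j)) (z i) = adj J (\prod_(j <- r) z j).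
    by apply: IH => j jr; [apply: regz|apply: wregz]; rewrite in_cons jr orbT.
  apply: ideal_ext => y; rewrite /colon; split=> -[b Jb]; exists b.
    by apply: (regz i); rewrite ?mem_head // mulrBr (mulrCA (z i) b).
  by rewrite (mulrCA b) -mulrBr; apply: ideal_mull.
suff -> : adj (adj J (z i * \prod_(j <- r) z j)) (z i) = adj J (z i).
  by apply: wregz; rewrite mem_head.
apply: ideal_ext => x; split; last by apply: adj_mono => y; apply: sub_adj.
apply: (@adj_min _ (adj J (z i)) (z i)); [exact: adj_ideal| |exact: mem_adj].
move=> y; apply: (@adj_min _ (adj J (z i))) => [|t|]; first exact: adj_ideal.
  exact: sub_adj.
by apply: ideal_mulr; [apply: adj_ideal|apply: mem_adj].
Qed.

Lemma reg_prod J (K : eqType) (r : seq K) (z : K -> A) :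
  (forall i, i \in r -> forall x, J (z i * x) -> J x) ->
  forall x, J ((\prod_(i <- r) z i) * x) -> J x.
Proof.
elim: r => [|i r IH] regz x; first by rewrite big_nil mul1r.
rewrite big_cons -mulrA => /regz; rewrite mem_head => /(_ isT).
by apply: IH => j jr; apply: regz; rewrite in_cons jr orbT.
Qed.

Lemma wreg_nth J s : wreg J s <->
  (forall i, (i < size s)%N -> forall x,
     foldl adj J (take i s) (s`_i * x) -> foldl adj J (take i s) x).
Proof.
elim: s J => //= a s IH J; rewrite IH; split=> [[rega regs] [|i]//=|regs].
  exact: regs.
by split=> [|i]; [apply: (regs 0%N)|apply: (regs i.+1)].
Qed.

Lemma gen_ideal_rcons s a x : gen_ideal (rcons s a) x <-> adj (gen_ideal s) a x.
Proof.
split=> [[c ->]|[b [c Dx]]].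
  exists (c (size s)), c; rewrite size_rcons big_ord_recr /= nth_rcons ltnn eqxx addrK.
  by apply: eq_bigr => i _; rewrite nth_rcons ltn_ord.
exists (fun i => if i == size s then b else c i).
rewrite size_rcons big_ord_recr /= nth_rcons ltnn !eqxx -[LHS](subrK (b * a)) Dx.
by congr (_ + _); apply: eq_bigr => i _; rewrite nth_rcons ltn_ord ltn_eqF.
Qed.

Definition zero_ideal : A -> Prop := fun x => x = 0.

Lemma zero_is_ideal : is_ideal zero_ideal.
Proof.
by split=> // [x y -> ->|a x ->]; rewrite /zero_ideal ?addr0 ?mulr0.
Qed.

Lemma foldl_adj_ideal J s : is_ideal J -> is_ideal (foldl adj J s).
Proof. by elim: s J => //= a s IH J iJ; apply/IH/adj_ideal. Qed.

Lemma gen_idealE s : gen_ideal s = foldl adj zero_ideal s.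
Proof.
elim/last_ind: s => [|s a IH].
  apply: ideal_ext => x; split=> [[c ->]|->]; rewrite /zero_ideal ?big_ord0 //.
  by exists (fun=> 0); rewrite big_ord0.
by rewrite -cats1 foldl_cat /= -IH cats1; apply: ideal_ext => x; apply: gen_ideal_rcons.
Qed.

Lemma gen_ideal_is_ideal s : is_ideal (gen_ideal s).
Proof. by rewrite gen_idealE; apply/foldl_adj_ideal/zero_is_ideal. Qed.

Lemma foldl_adj_min J P s x : is_ideal P -> (forall y, J y -> P y) ->
  {in s, forall a, P a} -> foldl adj J s x -> P x.
Proof.
move=> iP; elim: s J => [|a s IH] J JP Ps /=; first exact: JP.
apply: IH => [y|b sb]; last by apply: Ps; rewrite in_cons sb orbT.
by apply: adj_min => //; apply: Ps; rewrite mem_head.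
Qed.

Lemma gen_ideal_min P s x : is_ideal P ->
  {in s, forall a, P a} -> gen_ideal s x -> P x.
Proof.
by move=> iP Ps; rewrite gen_idealE; apply: foldl_adj_min => // y ->; apply: ideal0.
Qed.

Lemma sub_foldl_adj J s x : J x -> foldl adj J s x.
Proof. by elim: s J => //= a s IH J Jx; apply/IH/sub_adj. Qed.

Lemma mem_gen_ideal s a : a \in s -> gen_ideal s a.
Proof.
rewrite gen_idealE; move: (zero_is_ideal); move: zero_ideal => J.
elim: s J => //= b s IH J iJ; rewrite in_cons => /orP[/eqP->|/IH]; last first.
  by apply; apply: adj_ideal.
by apply: sub_foldl_adj; apply: mem_adj.
Qed.

Lemma regular_seq_wreg s : regular_seq s <-> ~ gen_ideal s 1 /\ wreg zero_ideal s.
Proof.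
by rewrite wreg_nth /regular_seq; split=> -[? regs]; split=> // i si x; move: (regs i si x);
  rewrite gen_idealE.
Qed.

End Ideals.

(** * Primes and prime chains in a noetherian ring *)

Section Noetherian.
Variable A : comPzRingType.
Hypothesis noeA : noetherian A.
Implicit Types (I J P : A -> Prop) (a u x y : A) (s : seq A).

(** Otherwise repeated choice yields a strictly increasing sequence in [F]; its union is a finitely
    generated ideal, hence already equals one of its terms. *)
Lemma noetherian_maximal (F : (A -> Prop) -> Prop) J0 :
  (forall J, F J -> is_ideal J) -> F J0 ->
  exists J, F J /\ forall I, F I -> (forall x, J x -> I x) -> forall x, I x -> J x.
Proof.
move=> idF FJ0; apply: contrapT => nomax.
have step J : exists I, F J -> F I /\ (forall x, J x -> I x) /\ exists x, I x /\ ~ J x.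
  case: (EM (F J)) => FJ; last by exists J.
  apply: contrapT => noI; apply: nomax; exists J; split=> // I FI JI x Ix.
  by apply: contrapT => nJx; apply: noI; exists I => _; split=> //; split=> //; exists x.
have [nxt nxtP] := choice step.
pose c t := iter t nxt J0.
have Fc t : F (c t) by elim: t => //= t /nxtP[].
have c_homo t t' x : (t <= t')%N -> c t x -> c t' x.
  move=> /subnKC <-; elim: (t' - t)%N => [|e IH]; first by rewrite addn0.
  by move/IH; rewrite addnS; apply: (nxtP _ (Fc _)).2.1.
pose U x := exists t, c t x.
have idU : is_ideal U.
  split=> [|x y [t cx] [t' cy]|a x [t cx]].
  - by exists 0%N; apply: (ideal0 (idF _ (Fc 0%N))).
  - exists (maxn t t'); apply: (idealD (idF _ (Fc _))).
      by apply: c_homo cx; apply: leq_maxl.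
    by apply: c_homo cy; apply: leq_maxr.
  - by exists t; apply: (ideal_mull _ (idF _ (Fc _))).
have [s Us] := noeA idU.
have [t ct] : exists t, {in s, forall a, c t a}.
  have : {in s, forall a, U a} by move=> a sa; apply/Us/mem_gen_ideal.
  elim: s {Us} => [|a s IH] Ua; first by exists 0%N.
  have [t ct] : exists t, {in s, forall a, c t a}.
    by apply: IH => b sb; apply: Ua; rewrite in_cons sb orbT.
  have [t' ct'] := Ua a (mem_head _ _).
  exists (maxn t t') => b; rewrite in_cons => /orP[/eqP->|/ct].
    by apply: c_homo ct'; apply: leq_maxr.
  by apply: c_homo; apply: leq_maxl.
have [_ [_ [x [cx ncx]]]] := nxtP _ (Fc t).
by apply: ncx; apply: (gen_ideal_min (idF _ (Fc t)) ct); apply/Us; exists t.+1.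
Qed.

(** An ideal [P] maximal among those that contain [J] and avoid [W] is prime: if [x] and [y] are
    outside, adjoining either one meets [W], and the product of the two elements met would lie in
    [P] as soon as [x * y] did. *)
Lemma prime_avoiding (W : A -> Prop) J : is_ideal J ->
  W 1 -> (forall x y, W x -> W y -> W (x * y)) -> (forall x, J x -> ~ W x) ->
  exists P, [/\ prime_ideal P, forall x, J x -> P x & forall x, P x -> ~ W x].
Proof.
move=> iJ W1 WM JW.
pose F I := [/\ is_ideal I, forall x, J x -> I x & forall x, I x -> ~ W x].
have [||P [[iP JP PW] Pmax]] := @noetherian_maximal F J; [by move=> I []|by split|].
exists P; split=> //; split=> // [/PW//|x y Pxy].
apply: contrapT => /not_orP[nPx nPy].
have meetW z : ~ P z -> exists w, W w /\ adj P z w.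
  move=> nPz; apply: contrapT => now; apply: nPz.
  apply: (Pmax (adj P z)); [split|by move=> t; apply: sub_adj|exact: mem_adj].
  - exact: adj_ideal.
  - by move=> t /JP; apply: sub_adj.
  - by move=> t Pt Wt; apply: now; exists t.
have [w [Ww [b Pb]]] := meetW x nPx; have [v [Wv [c Pc]]] := meetW y nPy.
apply: (PW (w * v)); last exact: WM.
have -> : w * v = (w - b * x) * v + b * x * (v - c * y) + b * c * (x * y) by ring.
apply: (idealD iP); last exact: ideal_mull.
by apply: (idealD iP); [apply: ideal_mulr|apply: ideal_mull].
Qed.

(* J stays proper after inverting a together with the complement of P. *)
Lemma smaller_prime J P a : is_ideal J -> prime_ideal P -> (forall x, J x -> P x) ->
  P a -> (forall x, J (a * x) -> J x) ->
  exists Q, [/\ prime_ideal Q, forall x, J x -> Q x, forall x, Q x -> P x & ~ Q a].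
Proof.
move=> iJ [iP nP1 primeP] JP Pa rega.
pose W x := exists t i, ~ P t /\ x = t * a ^+ i.
have [|x y [t [i [nPt ->]]] [t' [i' [nPt' ->]]]|x Jx [t [i [nPt Dx]]]|Q [primeQ JQ QW]] :=
  @prime_avoiding W J iJ.
- by exists 1, 0%N; rewrite expr0 mulr1.
- exists (t * t'), (i + i')%N; split; last by rewrite exprD mulrACA.
  by case/primeP.
- apply: nPt; apply: JP; move: Jx; rewrite {}Dx; elim: i => [|i IH]; first by rewrite expr0 mulr1.
  by rewrite exprS mulrCA => /rega.
exists Q; split=> // [x Qx|Qa].
  by apply: contrapT => nPx; apply: (QW x Qx); exists x, 0%N; rewrite expr0 mulr1.
by apply: (QW a Qa); exists 1, 1%N; rewrite expr1 mul1r.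
Qed.

(** The chain is built downwards. By induction there is one over [adj J a]; its lowest prime
    contains [a], and [smaller_prime] supplies a prime over [J] inside it that omits [a]. *)
Lemma wreg_prime_chain J P s : is_ideal J -> prime_ideal P -> (forall x, J x -> P x) ->
  wreg J s -> {in s, forall a, P a} ->
  exists c, prime_chain P (size s) c /\ forall x, J x -> c 0%N x.
Proof.
move=> iJ primeP; have iP : is_ideal P by case: primeP.
elim: s J iJ => [|a s IH] J iJ JP /=.
  by move=> _ _; exists (fun=> P); split.
move=> [rega regs] Ps.
have [||||c [[cprime cstrict cP] Jc]] := IH (adj J a).
- exact: adj_ideal.
- by move=> x; apply: adj_min => //; apply: Ps; rewrite mem_head.
- exact: regs.
- by move=> b sb; apply: Ps; rewrite in_cons sb orbT.
have [|Q [primeQ JQ Qc nQa]] := @smaller_prime J (c 0%N) a iJ (cprime 0%N isT) _ (Jc _ (mem_adj _ iJ)) rega.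
  by move=> x Jx; apply/Jc/sub_adj.
exists (fun i => if i is i'.+1 then c i' else Q); split=> //; split=> //.
- by case.
- case=> [_|i]; last exact: cstrict.
  by split=> //; exists a; split=> //; apply/Jc/mem_adj.
Qed.

End Noetherian.

(** * Zariski's lemma *)

Section Integral.
Variables (A : comNzRingType) (L : fieldType) (f : {rmorphism A -> L}).

Lemma integral_exp x i : integralOver f x -> integralOver f (x ^+ i).
Proof.
move=> intx; elim: i => [|i IH]; first by rewrite expr0; apply: integral1.
by rewrite exprS; apply: integral_mul.
Qed.

Lemma integral_sum (I : Type) (r : seq I) (Q : pred I) (F : I -> L) :
  (forall i, Q i -> integralOver f (F i)) -> integralOver f (\sum_(i <- r | Q i) F i).
Proof.
move=> intF; apply: big_ind => //; first exact: integral0.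
by move=> x y; apply: integral_add.
Qed.

(** With c the leading coefficient and N + 1 the degree, multiplying p(b) = 0 by c^N gives a monic
    equation for c b whose other coefficients are p_i c^(N - i). *)
Lemma integral_lead_coefM (p : {poly L}) b :
  p != 0 -> root p b -> (forall i, integralOver f p`_i) ->
  integralOver f (lead_coef p * b).
Proof.
move=> p0 rb intp; have sp : (1 < size p)%N.
  rewrite ltnNge; apply/negP => /size1_polyC Dp; move: p0 rb.
  by rewrite Dp polyC_eq0 rootC => /negPf->.
set N := (size p).-2; have sizep : size p = N.+2 by rewrite /N; lia.
set c := lead_coef p.
pose q : {poly L} := 'X^(N.+1) + \poly_(i < N.+1) (p`_i * c ^+ (N - i)).
have szq : (size (\poly_(i < N.+1) (p`_i * c ^+ (N - i))%R) < size ('X^(N.+1) : {poly L})%R)%N.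
  by rewrite size_polyXn ltnS size_poly.
apply: (@integral_root_monic _ _ f _ q).
- by rewrite monicE lead_coefDl // lead_coefXn.
- rewrite rootE /q hornerD hornerXn horner_poly exprMn.
  have -> : \sum_(i < N.+1) p`_i * c ^+ (N - i) * (c * b) ^+ i
          = c ^+ N * \sum_(i < N.+1) p`_i * b ^+ i.
    rewrite mulr_sumr; apply: eq_bigr => i _; rewrite exprMn.
    have -> : c ^+ N = c ^+ (N - i) * c ^+ i by rewrite -exprD subnK // -ltnS.
    by ring.
  have := rootP rb; rewrite horner_coef sizep big_ord_recr /=.
  have -> : p`_N.+1 = c by rewrite /c lead_coefE sizep.
  move=> /eqP; rewrite addr_eq0 => /eqP->; apply/eqP; rewrite exprS; ring.
- apply/integral_poly => i; rewrite coefD coefXn coef_poly; apply: integral_add.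
    exact: integral_nat.
  case: ifP => _; last exact: integral0.
  by apply: integral_mul => //; apply: integral_exp; apply: intp.
Qed.

(** Cancel powers of [w] from a monic equation until the constant term [c] has nonzero image; the
    equation then exhibits [f c / w] as a polynomial in [w]. *)
Lemma integral_clear_inv w : w != 0 -> integralOver f w ->
  exists g, f g != 0 /\ integralOver f (f g / w).
Proof.
move=> w0 intw; have [p] := intw; elim/poly_ind: p => [|p c IH].
  by rewrite monicE lead_coef0 eq_sym oner_eq0.
have [->|p0] := eqVneq p 0.
  rewrite mul0r add0r monicE lead_coefC => /eqP->.
  by rewrite rmorph1 rootC oner_eq0.
have szc : (size c%:P < size (p * 'X)%R)%N.
  by rewrite size_mulX // ltnS (leq_trans (size_polyC_leq1 _)) // lt0n size_poly_eq0.
rewrite monicE lead_coefDl // lead_coefMX => monp.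
rewrite rmorphD rmorphM /= map_polyX map_polyC /= rootE hornerD hornerMX hornerC => /eqP rw.
have [c0|c0] := eqVneq (f c) 0.
  apply: IH; first by rewrite monicE.
  by move/eqP: rw; rewrite c0 addr0 mulf_eq0 (negPf w0) orbF.
exists c; split=> //.
have -> : f c / w = - (map_poly f p).[w].
  apply: (canLR (mulfK w0)); rewrite mulNr; apply/eqP.
  by rewrite -addr_eq0 addrC rw.
apply: integral_opp; apply: integral_horner => //.
by apply/integral_poly => i; rewrite coef_map; apply: integral_id.
Qed.

Lemma integral_clear_horner (p : {poly A}) b c : integralOver f (f c * b) ->
  integralOver f (f c ^+ size p * (map_poly f p).[b]).
Proof.
move=> intb; rewrite (@horner_coef_wide _ (size p)) ?size_poly //.
rewrite mulr_sumr; apply: integral_sum => i _; rewrite coef_map.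
have -> : f c ^+ size p * (f p`_i * b ^+ i) = f p`_i * f c ^+ (size p - i) * (f c * b) ^+ i.
  have -> : f c ^+ size p = f c ^+ (size p - i) * f c ^+ i.
    by rewrite -exprD subnK // ltnW.
  by rewrite exprMn; ring.
do 2?[apply: integral_mul]; first exact: integral_id.
  by apply: integral_exp; apply: integral_id.
exact: integral_exp.
Qed.

(** Multiplying a monic equation of degree N for y by c^N leaves, since c y = a, the power a^N and
    terms divisible by c. *)
Lemma integral_fraction_dvd c a y : integralOver f y -> f c * y = f a ->
  exists d i, f c * f d = f a ^+ i.
Proof.
case=> p monp rp Dy; have sp : (0 < size p)%N by rewrite size_poly_gt0 monic_neq0.
set N := (size p).-1; have sizep : size p = N.+1 by rewrite prednK.
exists (- \sum_(i < N) p`_i * a ^+ i * c ^+ (N - i.+1)), N.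
have : f c ^+ N * (map_poly f p).[y] = 0 by rewrite (rootP rp) mulr0.
rewrite (@horner_coef_wide _ N.+1) -?sizep ?size_poly // sizep big_ord_recr /=.
rewrite coef_map /= [p`_N](_ : _ = 1); last by move/eqP: monp; rewrite lead_coefE.
rewrite rmorph1 mul1r mulrDr -exprMn Dy addrC => /eqP.
rewrite addr_eq0 => /eqP->; rewrite rmorphN mulrN; congr (- _).
rewrite rmorph_sum !mulr_sumr; apply: eq_bigr => i _ /=.
rewrite coef_map !rmorphM !rmorphXn /= -Dy exprMn.
have -> : f c ^+ N = f c * f c ^+ i * f c ^+ (N - i.+1).
  by rewrite -exprS -exprD subnKC.
by ring.
Qed.

End Integral.

(* The image domain f(A) is a G-domain (Goldman domain): its fraction field is
   f(A)[1/f(u)] for a single u. *)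
Definition goldman (A : comNzRingType) (L : fieldType) (f : A -> L) : Prop :=
  exists u, f u != 0 /\ forall c, f c != 0 -> exists d i, f c * f d = f u ^+ i.

Section GoldmanStep.
Variables (A : comNzRingType) (L : fieldType) (f : {rmorphism A -> L}) (b : L).
Let ev (p : {poly A}) : L := (map_poly f p).[b].

(* If b were transcendental over f(A), then 1 + X u would divide a power of u,
   to which it is coprime. *)
Lemma goldman_algebraic : goldman ev -> exists p, map_poly f p != 0 /\ ev p = 0.
Proof.
case=> u [u0 uP]; apply: contrapT => trans.
have inj p : ev p = 0 -> map_poly f p = 0.
  by move=> p0; have [//|pn0] := eqVneq (map_poly f p) 0; case: trans; exists p.
set v := map_poly f u; have v0 : v != 0.
  by apply: contraNneq u0 => v0; rewrite /ev -/v v0 horner0.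
set w := 1 + 'X * v; have Dw : map_poly f (1 + 'X * u) = w.
  by rewrite rmorphD rmorphM /= rmorph1 map_polyX.
have szw : (1 < size w)%N.
  have sv : (0 < size v)%N by rewrite size_poly_gt0.
  rewrite /w addrC size_polyDl ?(mulrC 'X) size_mulX // ?size_poly1 //.
have [|d [i Dd]] := uP (1 + 'X * u).
  apply/eqP => /inj; rewrite Dw => w0.
  by move: szw; rewrite w0 size_poly0.
have /inj/eqP : ev ((1 + 'X * u) * d - u ^+ i) = 0.
  rewrite /ev rmorphB rmorphM rmorphXn /= hornerD hornerN hornerM horner_exp.
  by apply/eqP; rewrite subr_eq0; apply/eqP.
rewrite rmorphB rmorphM rmorphXn /= Dw subr_eq0 => /eqP Dvi.
have cop : coprimep w (v ^+ i).
  apply: coprimep_expr; apply/Bezout_eq1_coprimepP; exists (1, - 'X) => /=.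
  by rewrite /w; ring.
have : w %| v ^+ i by rewrite -Dvi dvdp_mulr.
move=> wv; have := coprimep_dvdl wv cop; rewrite coprimepp => /eqP sw.
by rewrite sw in szw.
Qed.

(** Some g makes g b integral over the image of [A], and some h makes h / u integral. The new
    element is g h: if c d = u^i, then a power of g h divided by c is integral, so c divides a power
    of g h. *)
Lemma goldman_descend : goldman ev -> goldman f.
Proof.
move=> gold; have [p [p0 rp]] := goldman_algebraic gold.
have [u [u0 uP]] := gold.
have intc : integralOver f (lead_coef (map_poly f p) * b).
  apply: integral_lead_coefM => //; first by rewrite rootE; apply/eqP.
  by move=> i; rewrite coef_map; apply: integral_id.
move: p0; rewrite -lead_coef_eq0; move: intc.
rewrite lead_coefE coef_map /=; set g := p`_ _ => intg g0.
have w0 : f g ^+ size u * ev u != 0 by rewrite mulf_neq0 // expf_neq0.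
have [h [h0 inth]] := integral_clear_inv w0 (integral_clear_horner u intg).
have inthu : integralOver f (f h / ev u).
  have -> : f h / ev u = f g ^+ size u * (f h / (f g ^+ size u * ev u)).
    have x0 : f g ^+ size u != 0 by rewrite expf_neq0.
    by rewrite invfM mulrCA (mulrA _ _ (ev u)^-1) divff // mul1r.
  by apply: integral_mul => //; apply: integral_exp; apply: integral_id.
exists (g * h); split; first by rewrite rmorphM mulf_neq0.
move=> c c0; have [|d [i Dd]] := uP c%:P.
  by rewrite /ev map_polyC /= hornerC.
have {Dd}Dd : f c * ev d = ev u ^+ i by rewrite -Dd /ev map_polyC /= hornerC.
set M := (size d + i)%N.
pose y := f g ^+ i * f h ^+ size d * (f g ^+ size d * ev d) * (f h / ev u) ^+ i.
have inty : integralOver f y.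
  apply: integral_mul; last exact: integral_exp.
  apply: integral_mul; last exact: integral_clear_horner.
  by apply: integral_mul; apply: integral_exp; apply: integral_id.
have Dy : f c * y = f ((g * h) ^+ M).
  have -> : f c * y = f g ^+ i * f h ^+ size d * f g ^+ size d * (f c * ev d) * (f h / ev u) ^+ i.
    by rewrite /y; ring.
  rewrite Dd expr_div_n mulrACA mulfV ?expf_neq0 //.
  by rewrite rmorphXn rmorphM /= /M exprMn !exprD; ring.
have [d' [j Dj]] := integral_fraction_dvd inty Dy.
by exists d', (M * j)%N; rewrite Dj rmorphXn exprM.
Qed.

End GoldmanStep.

Section ZariskiLemma.
Variables (k L : fieldType) (h : {rmorphism k -> L}).

(** The subring of [L] generated by [bs] over [k] is represented by an evaluation map from an
    iterated polynomial ring. If its image is Goldman, so is the image one generator earlier, which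
    is then integral over [k] by induction; the last generator is algebraic over that image, hence
    integral, [k] being a field. *)
Lemma adjunction_tower (bs : seq L) :
  exists (A : comNzRingType) (f : {rmorphism A -> L}),
  [/\ forall c, exists a, f a = h c, {in bs, forall b, exists a, f a = b}
    & goldman f -> forall a, integralOver h (f a)].
Proof.
elim: bs => [|b bs [A [f [fC fbs fint]]]].
  by exists k, h; split=> // [c|_ a]; [exists c|apply: integral_id].
pose cfb : commr_rmorph f b := fun x => mulrC _ _.
exists {poly A}, (horner_morph cfb); split=> [c|x|gold a].
- by have [a <-] := fC c; exists a%:P; apply: (horner_morphC cfb).
- rewrite in_cons => /orP[/eqP->|/fbs[a <-]].
    by exists 'X; apply: (horner_morphX cfb).
  by exists a%:P; apply: (horner_morphC cfb).
have {}fint := fint (goldman_descend gold).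
have [p [p0 rp]] := goldman_algebraic gold.
apply: integral_horner; first by apply/integral_poly => i; rewrite coef_map; apply: fint.
apply: (integral_root p0); first by rewrite rootE; apply/eqP.
by apply/integral_poly => i; rewrite coef_map; apply: fint.
Qed.

Lemma zariski_lemma n (phi : {rmorphism {mpoly k[n]} -> L}) :
  (forall c, phi c%:MP = h c) -> (forall x, exists p, phi p = x) ->
  forall x, integralOver h x.
Proof.
move=> phiC surj; have [A [f [fC fX fint]]] :=
  adjunction_tower [seq phi 'X_i | i <- enum 'I_n].
have imf p : exists a, f a = phi p.
  elim/mpolyind: p => [|c m p _ _ [a Da]]; first by exists 0; rewrite !rmorph0.
  have [c' Dc] := fC c.
  have [m' Dm] : exists m', f m' = phi 'X_[m].
    rewrite mpolyXE_id rmorph_prod; apply: (big_ind (fun y => exists a, f a = y)).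
    - by exists 1; rewrite rmorph1.
    - by move=> _ _ [x <-] [y <-]; exists (x * y); rewrite rmorphM.
    move=> i _; have [|x Dx] := fX (phi 'X_i).
      by apply/mapP; exists i; rewrite ?mem_enum.
    by exists (x ^+ m i); rewrite !rmorphXn /= Dx.
  by exists (c' * m' + a); rewrite rmorphD rmorphM -mul_mpolyC rmorphD rmorphM /= Dc Dm Da phiC.
move=> x; have [p <-] := surj x; have [a <-] := imf p; apply: fint.
(* The image of [f] is the whole field [L], so it contains all inverses and 1 is a Goldman
   element. *)
exists 1; rewrite rmorph1 oner_eq0; split=> // c c0.
have [q Dq] := surj (f c)^-1; have [d Dd] := imf q.
by exists d, 0%N; rewrite Dd Dq expr0 divff.
Qed.

End ZariskiLemma.

(** * Hilbert's basis theorem *)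

(** Beyond any index [t] there is one at which [u] is least among all indices beyond [t]; iterating
    this choice gives the subsequence. *)
Lemma nondecreasing_subseq (u : nat -> nat) : exists phi : nat -> nat,
  {homo phi : i j / (i < j)%N} /\ {homo u \o phi : i j / (i <= j)%N}.
Proof.
have step t : exists m, (t < m)%N /\ forall m', (t < m')%N -> (u m <= u m')%N.
  pose P v := `[< exists m, (t < m)%N /\ u m = v >].
  have exP : exists v, P v by exists (u t.+1); apply/asboolP; exists t.+1.
  case: (ex_minnP exP) => _ /asboolP[m [tm <-]] minm; exists m; split=> // m' tm'.
  by apply: minm; apply/asboolP; exists m'.
have [nxt nxtP] := choice step.
exists (fun i => iter i.+1 nxt 0%N); split.
  by apply: homo_ltn => [? ? ?|i]; [apply: ltn_trans|apply: (nxtP _).1].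
apply: homo_leq => [//|? ? ?|i]; first exact: leq_trans.
rewrite /= ; apply: (nxtP (iter i nxt 0%N)).2.
by apply: (ltn_trans (nxtP (iter i nxt 0%N)).1); apply: (nxtP _).1.
Qed.

(** Thin the sequence out for one coordinate after another, then compare the first two terms
    left. *)
Lemma dickson n (f : nat -> 'X_{1..n}) :
  exists i j, (i < j)%N /\ (f i <= f j)%MM.
Proof.
have [phi [phi_lt phi_le]] : exists phi : nat -> nat, {homo phi : i j / (i < j)%N} /\
    forall l, l \in enum 'I_n -> {homo (fun i => f (phi i) l) : i j / (i <= j)%N}.
  elim: (enum 'I_n) => [|l s [phi [phi_lt phi_le]]]; first by exists id; split=> // l; rewrite in_nil.
  have [psi [psi_lt psi_le]] := nondecreasing_subseq (fun i => f (phi i) l).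
  exists (phi \o psi); split=> [i j ij|l']; first by apply/phi_lt/psi_lt.
  rewrite in_cons => /orP[/eqP->//|sl'] i j ij.
  by apply: (phi_le _ sl'); apply: (ltnW_homo psi_lt).
exists (phi 0%N), (phi 1%N); split; first exact: phi_lt.
by apply/mnm_lepP => l; apply: phi_le; rewrite ?mem_enum.
Qed.

(** If finite generation failed, one could keep choosing in [I], outside the ideal of the previous
    choices, an element with least leading monomial. By [dickson] some leading monomial divides a
    later one; cancelling the leading term of the later element gives zero or a smaller element,
    which by minimality lies in the ideal of the previous choices, and so does the later element. *)
Theorem hilbert_basis (k : fieldType) n : noetherian {mpoly k[n]}.
Proof.
move=> I iI; apply: contrapT => nofg.
have step s : exists g, {in s, forall a, I a} ->
    [/\ I g, ~ gen_ideal s g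
      & forall g', I g' -> (mlead g' < mlead g)%O -> gen_ideal s g'].
  have [sI|nsI] := EM {in s, forall a, I a}; last by exists 0.
  have [g [Ig sg]] : exists g, I g /\ ~ gen_ideal s g.
    apply: contrapT => nog; apply: nofg; exists s => x; split=> [Ix|]; last exact: gen_ideal_min.
    by apply: contrapT => sx; apply: nog; exists x.
  apply: contrapT => nomin; move: Ig sg.
  have [m Dm] : exists m, m = mlead g by exists (mlead g).
  elim/(well_founded_ind (@ltom_wf n)): m g Dm => m IH g Dm Ig sg.
  apply: nomin; exists g => _; split=> // g' Ig' lg'; apply: contrapT.
  by apply: (IH (mlead g')); rewrite ?Dm.
have [nxt nxtP] := choice step.
pose s := fix s t := if t is t'.+1 then rcons (s t') (nxt (s t')) else [::].
have sI t : {in s t, forall a, I a}.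
  elim: t => [//|t IH] a /=; rewrite mem_rcons in_cons => /orP[/eqP->|]; last exact: IH.
  by have [] := nxtP _ IH.
pose g t := nxt (s t).
have mem_s i j : (i < j)%N -> g i \in s j.
  elim: j => // j IH; rewrite ltnS leq_eqVlt /= mem_rcons in_cons => /orP[/eqP->|/IH->].
    by rewrite eqxx.
  by rewrite orbT.
have g0 t : g t != 0.
  apply/eqP => gt0; have [_ + _] := nxtP _ (sI t); rewrite -/(g t) gt0; apply.
  by apply: ideal0; apply: gen_ideal_is_ideal.
have [i [j [ij lij]]] := dickson (fun t => mlead (g t)).
have [Ij nsj minj] := nxtP _ (sI j); rewrite -/(g j) in Ij nsj minj.
set c := mleadc (g j) / mleadc (g i).
have c0 : c != 0 by rewrite mulf_neq0 ?invr_eq0 ?mleadc_eq0.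
set h := c *: ('X_[mlead (g j) - mlead (g i)] * g i).
have X0 (m : 'X_{1..n}) : 'X_[m] != 0 :> {mpoly k[n]}.
  by rewrite -msize_poly_eq0 -lt0n mmeasureX.
have lh : mlead h = mlead (g j) by rewrite mleadZ // mleadM // mleadXm submK.
have ch : h@_(mlead (g j)) = mleadc (g j).
  rewrite mcoeffZ (mulrC 'X_[_]) -[X in _@_X](submK lij) mcoeffMX /c.
  by rewrite divfK ?mleadc_eq0.
have sh : gen_ideal (s j) h.
  rewrite /h -mul_mpolyC; do 2!apply: (ideal_mull _ (gen_ideal_is_ideal _)).
  exact/mem_gen_ideal/mem_s.
have Ih : I h by apply: (gen_ideal_min iI (@sI j)).
have [E|d0] := eqVneq (g j - h) 0.
  by apply: nsj; move/eqP: E; rewrite subr_eq0 => /eqP->.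
apply/nsj/(ideal_subl (gen_ideal_is_ideal _) _ sh); apply: minj; first exact: idealB.
rewrite lt_neqAle; apply/andP; split.
  apply: contraNneq d0 => E.
  by rewrite -mleadc_eq0 E mcoeffB ch subrr.
by rewrite (le_trans (mleadB_le _ _)) // lh joinxx.
Qed.

(** * Parameters on the coordinate subspaces *)

Section PolyIdeal.
Variables (R : comNzRingType) (J : R -> Prop).
Hypothesis iJ : is_ideal J.

Definition poly_ideal : {poly R} -> Prop := fun p => forall l, J p`_l.

Lemma poly_ideal_is_ideal : is_ideal poly_ideal.
Proof.
split=> [l|p q Jp Jq l|p q Jq l]; first by rewrite coef0; apply: ideal0.
  by rewrite coefD; apply: idealD.
by rewrite coefM; apply: ideal_sum => // j _; apply: ideal_mull.
Qed.

Lemma poly_idealMC q x : J x -> poly_ideal (q * x%:P).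
Proof. by move=> Jx l; rewrite coefMC; apply: ideal_mull. Qed.

Lemma poly_ideal_horner p x : poly_ideal p -> J p.[x].
Proof.
move=> Jp; rewrite horner_coef; apply: ideal_sum => // j _.
exact: ideal_mulr.
Qed.

(** With d the degree of q, the coefficient of degree d + l of q p is p_l plus multiples of
    coefficients of p of higher index; so these enter [J] from the top down. *)
Lemma poly_ideal_monic q p : q \is monic -> poly_ideal (q * p) -> poly_ideal p.
Proof.
move=> monq Jqp; set d := (size q).-1.
have szq : size q = d.+1 by rewrite prednK // size_poly_gt0 monic_neq0.
have qd : q`_d = 1 by move/eqP: monq; rewrite lead_coefE.
suff Jp t l : (size p - t <= l)%N -> J p`_l.
  by move=> l; apply: (Jp (size p)); rewrite subnn.
elim: t l => [|t IH] l lt.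
  by rewrite nth_default; [apply: ideal0|rewrite -(subn0 (size p))].
have := Jqp (d + l)%N; rewrite coefM.
have ltd : (d < (d + l).+1)%N by rewrite ltnS leq_addr.
rewrite (bigD1 (Ordinal ltd)) //= qd mul1r addKn; set S := \sum_(_ < _ | _) _ => JpS.
rewrite -[p`_l](addrK S); apply: idealB => //; apply: ideal_sum => // j.
rewrite -val_eqE /= => jd; have [ltjd|ltdj] := ltnP j d.
  by apply: ideal_mull => //; apply: IH; lia.
rewrite nth_default ?mul0r; first exact: ideal0.
by rewrite szq ltn_neqAle eq_sym jd.
Qed.

(** Modulo [J] each factor with [i] outside [D] becomes ['X]. The lowest coefficient that can
    survive is thus the product of the [z i] over [D]. *)
Lemma coef_prod_XDC (K : finType) (z : K -> R) (D : {set K}) l :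
  (forall i, i \notin D -> J (z i)) ->
  J ((\prod_i ('X + (z i)%:P))`_l
     - ('X^(#|K| - #|D|) * \prod_(i in D) ('X + (z i)%:P))`_l).
Proof.
move=> Jz; rewrite -coefB; move: l; rewrite -/(poly_ideal _) (bigID (mem D)) /= mulrC.
rewrite -mulrBl; apply: (ideal_mulr _ poly_ideal_is_ideal).
have -> : (#|K| - #|D|)%N = size (enum (~: D)) by rewrite -cardE [RHS]cardsCs setCK.
rewrite (eq_bigl (mem (~: D))) => [|i]; last by rewrite /= inE.
rewrite -big_enum /=; have : all [pred i | i \notin D] (enum (~: D)).
  by apply/allP => i; rewrite mem_enum /= inE.
elim: (enum _) => [_|i r IH /= /andP[/Jz Jzi /IH {}IH]].
  by rewrite big_nil expr0 subrr; apply: ideal0; apply: poly_ideal_is_ideal.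
rewrite big_cons exprS mulrDl addrAC -mulrBr.
apply: (idealD poly_ideal_is_ideal); first exact: (ideal_mull _ poly_ideal_is_ideal).
apply: (ideal_mulr _ poly_ideal_is_ideal) => j; rewrite coefC.
by case: eqP => // _; apply: ideal0.
Qed.

End PolyIdeal.

Section SpecialVariable.
Variables (k : fieldType) (n : nat).
Local Notation R := {mpoly k[n]}.
Implicit Types (J : R -> Prop) (i : 'I_n).

(* Substitutes the polynomial variable for X_i. *)
Definition muni_at i : R -> {poly R} :=
  mmap (polyC \o @mpolyC n k) (fun l => if l == i then 'X else ('X_l)%:P).

HB.instance Definition _ i := GRing.RMorphism.copy (muni_at i)
  (mmap (polyC \o @mpolyC n k) (fun l => if l == i then 'X else ('X_l)%:P)).

Lemma muni_at_horner i p : (muni_at i p).['X_i] = p.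
Proof.
rewrite /muni_at; elim/mpolyind: p => [|c m p _ _ IH]; first by rewrite mmap0 horner0.
rewrite mmapD mmapZ mmapX hornerD hornerM /= hornerC IH mul_mpolyC; congr (_ *: _ + _).
rewrite /mmap1 horner_prod [RHS]mpolyXE_id; apply: eq_bigr => l _.
by rewrite horner_exp; case: eqP => [->|_]; rewrite ?hornerX ?hornerC.
Qed.

Lemma muni_atC i c : muni_at i c%:MP = (c%:MP)%:P.
Proof. exact: mmapC. Qed.

Lemma muni_atX i l : muni_at i 'X_l = if l == i then 'X else ('X_l)%:P.
Proof. by rewrite /muni_at mmapX mmap1U. Qed.

(** For an ideal this means being generated by polynomials free of ['X_i]. *)
Definition stable i J : Prop := forall p, J p -> poly_ideal J (muni_at i p).

Definition unipoly i (q : {poly k}) : R := (map_poly (@mpolyC n k) q).['X_i].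

Lemma muni_at_unipoly i l q :
  muni_at i (unipoly l q) = if l == i then map_poly (@mpolyC n k) q else (unipoly l q)%:P.
Proof.
rewrite /unipoly horner_coef rmorph_sum /=.
under eq_bigr => j _.
  rewrite coef_map rmorphM rmorphXn /= muni_atC muni_atX.
  over.
case: eqP => _.
  by rewrite -[RHS]coefK poly_def; apply: eq_bigr => j _; rewrite coef_map mul_polyC.
by rewrite rmorph_sum; apply: eq_bigr => j _; rewrite coef_map rmorphM rmorphXn.
Qed.

Lemma stable_adj i J a : is_ideal J -> muni_at i a = a%:P ->
  stable i J -> stable i (adj J a).
Proof.
move=> iJ ia sJ p [b Jp] l; exists (muni_at i b)`_l.
by have := sJ _ Jp l; rewrite rmorphB rmorphM /= ia coefB coefMC.
Qed.

Lemma stable_unipoly_reg i J q : is_ideal J -> stable i J -> q \is monic ->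
  forall x, J (unipoly i q * x) -> J x.
Proof.
move=> iJ sJ monq x /sJ; rewrite rmorphM /= muni_at_unipoly eqxx.
move/(poly_ideal_monic iJ (monic_map _ monq)) => Jx.
by rewrite -(muni_at_horner i x); apply: poly_ideal_horner.
Qed.

Variable q : 'I_n -> {poly k}.
Hypothesis monq : forall i, q i \is monic.
Let z i := unipoly i (q i).
(** For l at most n, the coefficient of degree l is the elementary symmetric function of degree n -
    l in the [z i]. *)
Definition parameter_poly : {poly R} := \prod_i ('X + (z i)%:P).

(* Modulo J the first parameter is the product of the z_i with i in D, so A/J
   with this parameter killed is filtered by the A/(J, z_i), to which induction
   applies. *)
Lemma wreg_parameters m J (D : {set 'I_n}) : is_ideal J -> #|D| = m ->
  (forall i, i \notin D -> J (z i)) -> (forall i, i \in D -> stable i J) ->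
  wreg J [seq parameter_poly`_l | l <- iota (n - m) m].
Proof.
elim: m J D => //= m IH J D iJ cD Jz sJ.
have mn : (m < n)%N by rewrite -cD -[X in (_ <= X)%N]card_ord max_card.
have regz i : i \in enum D -> forall x, J (z i * x) -> J x.
  by rewrite mem_enum => /sJ sJi; apply: stable_unipoly_reg.
(* Modulo [J] the polynomial is a power of ['X], of exponent [n - m.+1], times the product over [D];
   so this coefficient is the constant term of that product. *)
have Ja : J (parameter_poly`_(n - m.+1) - \prod_(i <- enum D) z i).
  have -> : \prod_(i <- enum D) z i
      = ('X^(#|'I_n| - #|D|) * \prod_(i in D) ('X + (z i)%:P))`_(n - m.+1).
    rewrite card_ord cD coefXnM ltnn subnn -horner_coef0 horner_prod big_enum.
    by apply: eq_bigr => i _; rewrite !hornerE.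
  exact: coef_prod_XDC.
split=> [x Jax|].
  apply: (reg_prod regz); apply: (ideal_subr iJ _ Jax).
  by rewrite -mulrBl; apply: ideal_mulr.
rewrite (adj_congr iJ Ja); apply: wreg_prod => // i; rewrite mem_enum => iD.
rewrite -subSn // subSS; apply: (IH _ (D :\ i)).
- exact: adj_ideal.
- by have := cardsD1 i D; rewrite iD cD => -[->].
- move=> l; rewrite in_setD1 negb_and negbK => /orP[/eqP->|/Jz]; first exact: mem_adj.
  exact: sub_adj.
move=> l; rewrite in_setD1 => /andP[li lD]; apply: stable_adj => //; last exact: sJ.
by rewrite muni_at_unipoly eq_sym (negPf li).
Qed.

Lemma parameter_mem J l : is_ideal J -> (forall i, J (z i)) -> (l < n)%N ->
  J parameter_poly`_l.
Proof.
move=> iJ Jz ln; have := @coef_prod_XDC _ J iJ _ z set0 l (fun i _ => Jz i).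
by rewrite big_set0 mulr1 cards0 subn0 card_ord coefXn ltn_eqF // subr0.
Qed.

End SpecialVariable.

(** * The prime ideal of an edge *)

Section EdgeIdeal.
Variables (k : fieldType) (n : nat).
Local Notation R := {mpoly k[n]}.
Implicit Types (e : 'I_n * 'I_n) (p : R).

Definition vid e : R -> Prop := gen_ideal [:: 'X_e.1; 'X_e.2].

Lemma vid_is_ideal e : is_ideal (vid e).
Proof. exact: gen_ideal_is_ideal. Qed.

Lemma vid_var e i : (i == e.1) || (i == e.2) -> vid e 'X_i.
Proof.
by move=> /orP[]/eqP->; apply: mem_gen_ideal; rewrite !inE eqxx ?orbT.
Qed.

Lemma coefMX_eq0 (p : R) (i : 'I_n) (m : 'X_{1..n}) : m i = 0%N -> (p * 'X_i)@_m = 0.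
Proof.
move=> mi; apply: memN_msupp_eq0; rewrite (perm_mem (msuppMX _ _)).
apply/mapP => -[m' _ Dm]; move: mi; rewrite Dm mnmDE mnm1E eqxx.
by lia.
Qed.

Lemma vidP e p : vid e p <-> forall m : 'X_{1..n}, m e.1 = 0%N -> m e.2 = 0%N -> p@_m = 0.
Proof.
split=> [/gen_ideal2[u [v ->]] m m1 m2|p0].
  by rewrite mcoeffD !coefMX_eq0 // addr0.
rewrite [p]mpolyE big_seq; apply: ideal_sum => [|m]; first exact: vid_is_ideal.
rewrite mcoeff_msupp => pm; rewrite -mul_mpolyC; apply: (ideal_mull _ (vid_is_ideal e)).
have [i [ie mi]] : exists i, ((i == e.1) || (i == e.2)) /\ m i != 0%N.
  have [m1|m1] := eqVneq (m e.1) 0%N; last by exists e.1; rewrite eqxx.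
  have [m2|m2] := eqVneq (m e.2) 0%N; last by exists e.2; rewrite eqxx orbT.
  by rewrite p0 ?eqxx in pm.
have -> : 'X_[m] = 'X_[m - U_(i)] * 'X_i :> R by rewrite -mpolyXD submK // lep1mP.
by apply: (ideal_mull _ (vid_is_ideal e)); apply: vid_var.
Qed.

Lemma stable_vid e i : i != e.1 -> i != e.2 -> stable i (vid e).
Proof.
move=> i1 i2 p /gen_ideal2[u [v ->]].
have Xl j : i != j -> muni_at i 'X_j = ('X_j)%:P :> {poly R}.
  by move=> ij; rewrite muni_atX eq_sym (negPf ij).
have Ml (w : R) j : i != j -> muni_at i (w * 'X_j) = muni_at i w * ('X_j)%:P.
  by move=> ij; rewrite rmorphM /= Xl.
have -> : muni_at i ((u : R) * 'X_e.1 + (v : R) * 'X_e.2)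
    = muni_at i u * ('X_e.1)%:P + muni_at i v * ('X_e.2)%:P.
  by rewrite rmorphD /= !Ml.
apply: (idealD (poly_ideal_is_ideal (vid_is_ideal e)));
  by apply: (poly_idealMC (vid_is_ideal e)); apply: vid_var; rewrite eqxx ?orbT.
Qed.

(** [D] is the complement of the two ends. For an end [i] the vanishing constant coefficient makes
    z_i a multiple of ['X_i]; for any other [i] the generators of [vid e] are free of ['X_i]. *)
Lemma wreg_vid e (q : 'I_n -> {poly k}) : e.1 != e.2 ->
  (forall i, q i \is monic) -> (forall i, (q i)`_0 = 0) ->
  wreg (vid e) [seq (parameter_poly q)`_l | l <- iota 2 (n - 2)].
Proof.
move=> ne monq q0; have c2 : #|[set e.1; e.2]| = 2%N by rewrite cards2 ne.
have n2 : (2 <= n)%N by rewrite -c2 -[X in (_ <= X)%N]card_ord max_card.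
rewrite -{1}[2%N](subKn n2); apply: (@wreg_parameters _ _ _ monq _ _ (~: [set e.1; e.2])).
- exact: vid_is_ideal.
- by rewrite cardsCs setCK card_ord c2.
- move=> i; rewrite inE negbK in_set2 => /vid_var ei; rewrite /unipoly horner_coef.
  apply: ideal_sum => [|[[|l] ?] _] /=; first exact: vid_is_ideal.
    by rewrite coef_map /= q0 mpolyC0 mul0r; apply: (ideal0 (vid_is_ideal e)).
  by rewrite exprSr mulrA; apply: (ideal_mull _ (vid_is_ideal e)).
- by move=> i; rewrite !inE negb_or => /andP[]; apply: stable_vid.
Qed.

End EdgeIdeal.

(** * Adding edges *)

Section Shelling.
Variables (k : fieldType) (n : nat).
Local Notation R := {mpoly k[n]}.
Implicit Types (e : 'I_n * 'I_n) (p : R) (X Y : {set 'I_n * 'I_n}).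

Definition ends e : {set 'I_n} := [set e.1; e.2].

(** The cover ideal of the graph [X], spanned over [k] by the monomials whose support is a vertex
    cover. *)
Definition cover_ideal X : R -> Prop := fun p => forall e, e \in X -> vid e p.

Lemma cover_ideal_is_ideal X : is_ideal (cover_ideal X).
Proof.
split=> [e _|p q Xp Xq e eX|a p Xp e eX]; have ie := @vid_is_ideal k n e.
- exact: ideal0.
- by apply: idealD; [|apply: Xp|apply: Xq].
- by apply: ideal_mull; [|apply: Xp].
Qed.

Lemma vid_ends e e' p : ends e = ends e' -> vid e p -> vid e' p.
Proof.
move=> ee' /vidP ep; apply/vidP => m m1 m2.
have m0 i : i \in ends e -> m i = 0%N by rewrite ee' in_set2 => /orP[]/eqP->.
by apply: ep; apply: m0; rewrite !inE eqxx ?orbT.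
Qed.

Definition nbr Y e v : bool :=
  (v \notin ends e) && [exists w in ends e, ((w, v) \in Y) || ((v, w) \in Y)].

Definition nbr_mnm Y e : 'X_{1..n} := [multinom nat_of_bool (nbr Y e v) | v < n].

Section AddEdge.
Variables (X : {set 'I_n * 'I_n}) (e : 'I_n * 'I_n).
Hypothesis eX : e \in X.
Let Y := X :\ e.
Hypothesis Ye : forall e', e' \in Y -> exists v, v \in ends e' /\ nbr Y e v.
Let f : R := 'X_[nbr_mnm Y e].

Lemma coverY_nbr : cover_ideal Y f.
Proof.
move=> e' /Ye[v [ve' nv]]; apply/vidP => m m1 m2; rewrite mcoeffX.
case: eqP => // Dm; suff: m v = 0%N by rewrite -Dm mnmE nv.
by move: ve'; rewrite in_set2 => /orP[]/eqP->.
Qed.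

Lemma coverXE p : cover_ideal X p <-> vid e p /\ cover_ideal Y p.
Proof.
split=> [Xp|[ep Yp] e' e'X].
  by split=> [|e' /setD1P[_]]; apply: Xp.
by have [->//|ne] := eqVneq e' e; apply: Yp; rewrite in_setD1 ne.
Qed.

(** The monomial [f] is in the cover ideal of [Y] and free of both ends of [e], so multiplying by it
    cannot bring a new polynomial into [vid e]. *)
Lemma colon_nbr : colon (cover_ideal X) f = vid e.
Proof.
have mf0 i : i \in ends e -> nbr_mnm Y e i = 0%N by rewrite mnmE /nbr => ->.
apply: ideal_ext => p; rewrite /colon coverXE; split=> [[/vidP fp _]|ep]; last first.
  split; first by apply: (ideal_mull _ (vid_is_ideal k e)).
  exact: (ideal_mulr _ (cover_ideal_is_ideal _) coverY_nbr).
apply/vidP => m m1 m2; rewrite -(mcoeffMX _ (nbr_mnm Y e)) mulrC.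
by apply: fp; rewrite mnmDE mf0 // !inE eqxx ?orbT.
Qed.

(** Let p lie in the cover ideal of [Y]. A term of p free of both ends of [e] has to contain every
    neighbour of [e], hence is divisible by [f]; [b] collects the quotients. All other terms lie in
    [vid e]. *)
Lemma adj_nbr : adj (cover_ideal X) f = cover_ideal Y.
Proof.
apply: ideal_ext => p; split=> [|Yp].
  apply: adj_min; first exact: cover_ideal_is_ideal; last exact: coverY_nbr.
  by move=> x /coverXE[].
pose b : R := \sum_(m <- msupp p | (m e.1 == 0%N) && (m e.2 == 0%N))
  p@_m *: 'X_[m - nbr_mnm Y e].
exists b; apply/coverXE; split; last first.
  apply: (idealB (cover_ideal_is_ideal _)) => //.
  exact: (ideal_mull _ (cover_ideal_is_ideal _) coverY_nbr).
have -> : p - b * f = \sum_(m <- msupp p | ~~ ((m e.1 == 0%N) && (m e.2 == 0%N))) p@_m *: 'X_[m].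
  rewrite {1}[p]mpolyE (bigID (fun m : 'X_{1..n} => (m e.1 == 0%N) && (m e.2 == 0%N))) /=.
  rewrite addrAC [X in X - _](_ : _ = b * f) ?subrr ?add0r //.
  rewrite /b mulr_suml big_seq_cond [RHS]big_seq_cond.
  apply: eq_bigr => m /andP[mp /andP[/eqP m1 /eqP m2]].
  rewrite -scalerAl -mpolyXD submK //; apply/mnm_lepP => v; rewrite mnmE.
  case nv: (nbr Y e v) => //; move: nv; rewrite /nbr => /andP[_ /existsP[w /andP[we wv]]].
  rewrite lt0n; apply: contraTneq mp => mv; rewrite -mcoeff_eq0; apply/eqP.
  have mw : m w = 0%N by move: we; rewrite in_set2 => /orP[]/eqP->.
  by case/orP: wv => /Yp/vidP; apply.
apply: ideal_sum => [|m nm]; first exact: vid_is_ideal.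
apply/vidP => m' m1 m2; rewrite mcoeffZ mcoeffX; case: eqP => [Dm|_]; last by rewrite mulr0.
by move: nm; rewrite Dm m1 m2.
Qed.

Lemma wreg_add_edge s : wreg (@vid k n e) s -> wreg (cover_ideal Y) s ->
  wreg (cover_ideal X) s.
Proof.
move=> wrege wregY; apply: (@wreg_colon _ _ f); first exact: cover_ideal_is_ideal.
  by rewrite colon_nbr.
by rewrite adj_nbr.
Qed.

End AddEdge.

Definition joins e'' e e' : Prop := exists w v,
  [/\ w \in ends e, v \in ends e' & e'' = (w, v) \/ e'' = (v, w)].

(* [rank] is a linear-quotient order for the edge ideal, the Alexander dual of
   the cover ideal. *)
Lemma wreg_cover (rank : 'I_n * 'I_n -> nat) X s :
  (forall e, e \in X -> e.1 != e.2) ->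
  (forall e, e \in X -> wreg (@vid k n e) s) ->
  (forall e e', e \in X -> e' \in X -> [disjoint ends e & ends e'] ->
    (rank e' <= rank e)%N ->
    exists e'', [/\ e'' \in X, (rank e'' < rank e)%N & joins e'' e e']) ->
  wreg (cover_ideal X) s.
Proof.
have [N] := ubnP #|X|; elim: N X => // N IH X ltXN neX wregX linkX.
have [->|/set0Pn[e0 e0X]] := eqVneq X set0.
  by apply: wreg_full => [e|]; [rewrite inE|apply: cover_ideal_is_ideal].
case: (@arg_maxnP _ e0 (mem X) rank e0X) => e eX maxe; rewrite /= in eX maxe.
set Y := X :\ e; have subYX e' : e' \in Y -> e' \in X by move=> /setD1P[].
have wregY : wreg (cover_ideal Y) s.
  apply: IH.
  - by move: ltXN; rewrite (cardsD1 e) eX ltnS.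
  - by move=> e' /subYX; apply: neX.
  - by move=> e' /subYX; apply: wregX.
  move=> e1 e2 Y1 Y2 dis r21; have [e'' [X'' r'' j'']] := linkX _ _ (subYX _ Y1) (subYX _ Y2) dis r21.
  exists e''; split=> //; rewrite in_setD1 X'' andbT; apply: contraTneq r'' => ->.
  by rewrite -leqNgt; apply/maxe/subYX.
have [/existsP[e' /andP[Y' /eqP ee']]|/existsPn nopar] :=
  boolP [exists e', (e' \in Y) && (ends e' == ends e)].
  suff -> : cover_ideal X = cover_ideal Y by [].
  apply: ideal_ext => p; rewrite (coverXE eX); split=> [[]//|Yp]; split=> //.
  by apply: (vid_ends ee'); apply: Yp.
apply: (@wreg_add_edge _ e) => // [e' Y'|]; last exact: wregX.
have [dis|] := boolP [disjoint ends e & ends e'].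
  have [e'' [X'' r'' [w [v [we ve' D'']]]]] := linkX _ _ eX (subYX _ Y') dis (maxe _ (subYX _ Y')).
  exists v; split=> //; apply/andP; split.
    by apply: contraL dis => ve; apply/pred0Pn; exists v; rewrite /= ve ve'.
  have Y'' : e'' \in Y by rewrite in_setD1 X'' andbT; apply: contraTneq r'' => ->; rewrite ltnn.
  by apply/existsP; exists w; rewrite we; case: D'' Y'' => -> ->; rewrite ?orbT.
(* If [e'] meets [e] in [w], its other end is outside [e], there being no parallel edge, and [e']
   itself joins that end to [w]. *)
case/pred0Pn => w /= /andP[we we'].
have [/subsetP sub|/subsetPn[v ve' ve]] := boolP (ends e' \subset ends e).
  have := nopar e'; rewrite Y' /= eqEcard; have -> : ends e' \subset ends e by apply/subsetP.
  by rewrite !cards2 !neX // subYX.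
exists v; split=> //; rewrite /nbr ve; apply/existsP; exists w; rewrite we /=.
have: w != v by apply: contraNneq ve => <-.
move: Y' we' ve'; rewrite /ends; case: e' => a b /=; rewrite !in_set2.
by move=> Y' /orP[]/eqP-> /orP[]/eqP-> //; rewrite ?eqxx // Y' ?orbT.
Qed.

End Shelling.

(** * Length of prime chains *)

Lemma big_tuple_cons (V : nmodType) (T : finType) e (F : e.+1.-tuple T -> V) :
  \sum_t F t = \sum_a \sum_(t : e.-tuple T) F [tuple of a :: t].
Proof.
rewrite pair_big /= (reindex (fun p : T * e.-tuple T => [tuple of p.1 :: p.2])) //=.
exists (fun t => (thead t, [tuple of behead t])) => [[a t] _|t _] /=.
  by rewrite theadE; congr (_, _); apply: val_inj.
by rewrite [RHS]tuple_eta; apply: val_inj.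
Qed.

Section Transcendence.
Variables (k : fieldType) (n : nat).
Local Notation R := {mpoly k[n]}.

Lemma prime_expM (P : R -> Prop) y a x : prime_ideal P -> ~ P y -> P (y ^+ a * x) -> P x.
Proof.
case=> _ _ primeP nPy; elim: a => [|a IH]; first by rewrite expr0 mul1r.
by rewrite exprS -mulrA => /primeP[].
Qed.

Lemma prime_lowest_coef (P : R -> Prop) (y : R) N (g : nat -> R) a :
  prime_ideal P -> ~ P y -> (a < N)%N -> (forall b, (b < a)%N -> g b = 0) ->
  P (\sum_(b < N) y ^+ b * g b) -> exists w, P (g a + y * w).
Proof.
move=> pP nPy aN g0; rewrite -(big_mkord xpredT (fun b => y ^+ b * g b)).
rewrite (@big_cat_nat _ _ _ a) ?(ltnW aN) //= big1_seq ?add0r; last first.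
  by move=> b; rewrite mem_index_iota => /andP[_ /andP[_ /g0->]]; rewrite mulr0.
rewrite big_ltn // => Pya; exists (\sum_(a.+1 <= b < N) y ^+ (b - a.+1) * g b).
move: Pya; have -> : \sum_(a.+1 <= b < N) y ^+ b * g b
     = y ^+ a * (y * \sum_(a.+1 <= b < N) y ^+ (b - a.+1) * g b).
  rewrite !mulr_sumr !big_seq; apply: eq_bigr => b; rewrite mem_index_iota => /andP[ab _].
  by rewrite mulrA mulrA -exprSr -exprD subnKC.
by rewrite -mulrDr; apply: prime_expM.
Qed.

(* The elements y_l chosen in the successive steps of a prime chain are
   algebraically independent over k modulo its bottom prime: the lowest
   coefficient of a relation can be extracted one variable at a time. *)
Lemma chain_independent (c : nat -> R -> Prop) (y : nat -> R) N e s
    (v : e.-tuple 'I_N -> k) :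
  (forall l, (l <= e)%N -> prime_ideal (c (s + l)%N)) ->
  (forall l, (l < e)%N ->
     [/\ forall x, c (s + l)%N x -> c (s + l).+1 x, c (s + l).+1 (y (s + l)%N)
       & ~ c (s + l)%N (y (s + l)%N)]) ->
  c s (\sum_t v t *: \prod_(l < e) y (s + l)%N ^+ tnth t l) -> forall t, v t = 0.
Proof.
elim: e s v => [|e IH] s v cprime cy.
  rewrite (big_pred1 [tuple]) => [|t]; last by apply/esym/eqP; apply: tuple0.
  rewrite big_ord0 => cv t; rewrite tuple0.
  have [//|v0] := eqVneq (v [tuple]) 0; have [ic c1 _] := cprime 0%N isT.
  case: c1; rewrite addn0; rewrite addn0 in ic.
  have -> : 1 = (v [tuple])^-1%:MP * (v [tuple] *: 1) :> R.
    by rewrite mul_mpolyC scalerA mulVf // scale1r.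
  exact: ideal_mull.
rewrite big_tuple_cons => cv.
pose G (a : 'I_N) := \sum_(t : e.-tuple 'I_N)
  v [tuple of a :: t] *: \prod_(l < e) y (s.+1 + l)%N ^+ tnth t l.
have {}cv : c s (\sum_(a < N) y s ^+ a * G a).
  suff -> : \sum_(a < N) y s ^+ a * G a = \sum_a \sum_(t : e.-tuple 'I_N)
      v [tuple of a :: t] *: \prod_(l < e.+1) y (s + l)%N ^+ tnth [tuple of a :: t] l by [].
  apply: eq_bigr => a _; rewrite mulr_sumr; apply: eq_bigr => t _.
  rewrite -scalerAr big_ord_recl addn0 tnth0; congr (_ *: (_ * _)).
  by apply: eq_bigr => l _; rewrite tnthS addSnnS.
suff v0 (a : 'I_N) : forall t : e.-tuple 'I_N, v [tuple of a :: t] = 0.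
  by move=> t; rewrite (tuple_eta t).
have [+ +] := (cprime 0%N isT, cy 0%N isT); rewrite addn0 => primec [sub cSy ncy].
have [iS _ _] := cprime 1%N isT; rewrite addn1 in iS.
(* Once the coefficients with smaller first exponent vanish, [G a + y s * w] lies in [c s] for some
   [w]; since [y s] is in [c s.+1], so is [G a], and the induction on [e] applies there. *)
have [r] := ubnP (a : nat); elim: r a => // r IHr a ar.
pose g b := if insub b is Some b' then G b' else 0.
have gE (b : 'I_N) : g b = G b by rewrite /g valK.
have [b ba||w cw] := @prime_lowest_coef _ (y s) N g a primec ncy (ltn_ord a).
- rewrite /g; case: insubP => // b' _ Db; rewrite /G big1 // => t _.
  by rewrite IHr ?scale0r // Db; lia.
- by under eq_bigr => b _ do rewrite gE.
apply: (IH s.+1) => [l le|l le|].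
- by rewrite addSnnS; apply: cprime.
- by have := cy l.+1 le; rewrite addSnnS.
rewrite -/(G a) -gE; move/sub: cw; rewrite -[X in c s.+1 X -> _]opprK opprD.
move=> cw; have -> : g a = (g a + y s * w) - w * y s by ring.
apply: idealB => //; last exact: ideal_mull.
by move: cw; rewrite -opprD opprK.
Qed.

Definition degree_le (p : R) d := {in msupp p, forall m, (mdeg m <= d)%N}.

Lemma degree_leM p q d d' : degree_le p d -> degree_le q d' -> degree_le (p * q) (d + d').
Proof.
move=> pd qd m /msuppM_le/allpairsP[[m1 m2] /= [/pd h1 /qd h2 ->]].
by rewrite mdegD leq_add.
Qed.

Lemma degree_leW p d d' : (d <= d')%N -> degree_le p d -> degree_le p d'.
Proof. by move=> dd' pd m /pd/leq_trans; apply. Qed.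

Lemma degree_le1 d : degree_le 1 d.
Proof. by move=> m; rewrite msupp1 inE => /eqP->; rewrite mdeg0. Qed.

Lemma degree_leX p d a : degree_le p d -> degree_le (p ^+ a) (a * d).
Proof.
move=> pd; elim: a => [|a IH]; first by rewrite expr0; apply: degree_le1.
by rewrite exprS mulSn; apply: degree_leM.
Qed.

Lemma degree_le_prod (I : finType) (F : I -> R) d :
  (forall i, degree_le (F i) d) -> degree_le (\prod_i F i) (#|I| * d).
Proof.
move=> Fd; rewrite cardE -big_enum; elim: (enum I) => [|i r IH].
  by rewrite big_nil; apply: degree_le1.
by rewrite big_cons mulSn; apply: degree_leM.
Qed.

(** Modulo [vid e] only monomials free of both ends count. In degree at most [D] these are among the
    (D + 1)^(n - 2) monomials [mnm g], so the coefficient matrix [A] has more rows than columns. *)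
Lemma vid_dependent (e : 'I_n * 'I_n) (I : finType) (Y : I -> R) D :
  e.1 != e.2 -> (forall t, degree_le (Y t) D) -> (D.+1 ^ (n - 2) < #|I|)%N ->
  exists v : I -> k, (exists t, v t != 0) /\ vid e (\sum_t v t *: Y t).
Proof.
move=> ne Yd ltI.
pose V := {i : 'I_n | i \notin [set e.1; e.2]}.
pose G : finType := {ffun V -> 'I_D.+1}.
have cG : #|G| = (D.+1 ^ (n - 2))%N.
  rewrite card_ffun card_ord card_sig; congr (_ ^ _)%N.
  have -> : #|[pred i | i \notin [set e.1; e.2]]| = #|~: [set e.1; e.2]|.
    by apply: eq_card => i; rewrite !inE.
  by rewrite cardsCs setCK card_ord cards2 ne.
pose mnm (g : G) : 'X_{1..n} :=
  [multinom if insub i is Some i' then nat_of_ord (g (i' : V)) else 0%N | i < n].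
pose A : 'M[k]_(#|I|, #|G|) := \matrix_(i, j) (Y (enum_val i))@_(mnm (enum_val j)).
have kerA : kermx A != 0.
  rewrite -mxrank_eq0 mxrank_ker subn_eq0 -ltnNge.
  by apply: leq_ltn_trans (rank_leq_col A) _; rewrite cG.
have [u /sub_kermxP uA u0] := rowV0Pn kerA.
exists (fun t => u 0 (enum_rank t)); split.
  apply: contrapT => v0; case/eqP: u0; apply/rowP => i; rewrite mxE.
  have [//|ui] := eqVneq (u 0 i) 0; case: v0.
  by exists (enum_val i); rewrite enum_valK.
apply/vidP => m m1 m2; rewrite raddf_sum /=.
have [le|gt] := leqP (mdeg m) D; last first.
  apply: big1 => t _; rewrite mcoeffZ memN_msupp_eq0 ?mulr0 //.
  by apply/negP => /Yd; rewrite leqNgt gt.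
have mi i : (m i < D.+1)%N.
  by rewrite ltnS (leq_trans _ le) // mdegE (bigD1 i) //= leq_addr.
pose g : G := [ffun i : V => Ordinal (mi (val i))].
have gm : mnm g = m.
  apply/mnmP => i; rewrite mnmE; case: insubP => [i' _ Di|]; first by rewrite ffunE /= Di.
  by rewrite negbK in_set2 => /orP[]/eqP->.
have /rowP/(_ (enum_rank g)) := uA; rewrite !mxE => E; rewrite -[RHS]E.
rewrite [RHS](reindex (@enum_rank I)) /=; last exact: onW_bij (enum_rank_bij I).
by apply: eq_bigr => t _; rewrite mcoeffZ mxE !enum_rankK gm.
Qed.

(** Otherwise n - 1 elements would be algebraically independent modulo [vid e]; but their N^(n - 1)
    products with exponents below N have degrees linear in N, so they span a space of dimension only
    O(N^(n - 2)) there. *)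
Lemma chain_length_le (e : 'I_n * 'I_n) d (c : nat -> R -> Prop) :
  e.1 != e.2 -> (forall i, (i <= d)%N -> prime_ideal (c i)) ->
  (forall i, (i < d)%N -> (forall x, c i x -> c i.+1 x) /\ (exists x, c i.+1 x /\ ~ c i x)) ->
  (forall x, vid e x -> c 0%N x) -> (d <= n - 2)%N.
Proof.
move=> ne cprime cstrict vc; rewrite leqNgt; apply/negP => ltd.
have ex i : exists x, (i < d)%N -> c i.+1 x /\ ~ c i x.
  have [id|] := ltnP i d; last by exists 0.
  by have [_ [x cx]] := cstrict i id; exists x.
have [y yP] := choice ex.
set h := (n - 2)%N in ltd.
have [D0 yD] : exists D0, forall l, (l < h.+1)%N -> degree_le (y l) D0.
  exists (\max_(l < h.+1) msize (y l)) => l lh m my.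
  apply: leq_trans (ltnW (msize_mdeg_lt my)) _.
  exact: (@leq_bigmax _ (fun l : 'I_h.+1 => msize (y l)) (Ordinal lh)).
(* Chosen so that the degrees stay below C N while C^h N^h < N^(h + 1). *)
pose C := (h.+1 * D0).+1; pose N := (C ^ h).+1.
pose Y (t : h.+1.-tuple 'I_N) := \prod_(l < h.+1) y (0 + l)%N ^+ tnth t l.
have YD t : degree_le (Y t) (h.+1 * (N.-1 * D0)).
  rewrite -{1}[h.+1]card_ord; apply: degree_le_prod => l.
  have yl : degree_le (y (0 + l)%N) D0 by rewrite add0n; apply: yD.
  apply: (@degree_leW _ (tnth t l * D0)); last exact: degree_leX.
  by rewrite leq_mul2r; apply/orP; right; have := ltn_ord (tnth t l); rewrite ltnS.
have [|v [[t vt] vY]] := vid_dependent ne YD.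
  rewrite card_tuple card_ord -/h expnS.
  have le : ((h.+1 * (N.-1 * D0)).+1 <= C * N)%N by rewrite /C /N /=; nia.
  apply: (@leq_ltn_trans ((C * N) ^ h)%N); first by case: (h) le => // h' le; rewrite leq_exp2r.
  by rewrite expnMn ltn_pmul2r ?expn_gt0.
case/eqP: vt.
apply: (@chain_independent c y N h.+1 0%N v) => [l le|l le|].
- by apply: cprime; apply: leq_trans le _.
- have ld : (l < d)%N by apply: leq_trans le _.
  by have [sub _] := cstrict l ld; have [] := yP l ld.
exact: vc.
Qed.

End Transcendence.

(** * Residue fields *)

Lemma maximal_ideal_inverse (A : comPzRingType) (M : A -> Prop) x :
  maximal_ideal M -> ~ M x -> exists y, M (1 - y * x).
Proof.
move=> [iM nM1 maxM] nMx; apply: contrapT => noy; apply: nMx.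
apply: (maxM (adj M x)); [exact: adj_ideal| |by move=> ?; apply: sub_adj|exact: mem_adj].
by case=> y My; apply: noy; exists y.
Qed.

Lemma maximal_ideal_prime (A : comPzRingType) (M : A -> Prop) :
  maximal_ideal M -> prime_ideal M.
Proof.
move=> maxM; have [iM nM1 _] := maxM; split=> // x y Mxy.
have [Mx|nMx] := EM (M x); [by left|right].
have [z Mz] := maximal_ideal_inverse maxM nMx.
have -> : y = (1 - z * x) * y + z * (x * y) by ring.
by apply: idealD => //; [apply: ideal_mulr|apply: ideal_mull].
Qed.

(** The proofs are packed with the ideal so that its quotient can carry a canonical field structure.
    Maximality takes the form of inverses modulo the ideal, which pulls back easily along a
    surjection. *)
Record maxideal (R : comNzRingType) := Maxideal {
  maxideal_car : R -> Prop;
  maxideal_id : is_ideal maxideal_car;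
  maxideal_1 : ~ maxideal_car 1;
  maxideal_inv : forall x, ~ maxideal_car x -> exists y, maxideal_car (1 - y * x) }.

Section ResidueField.
Variables (R : comNzRingType) (M : maxideal R).

Definition maxideal_pred : {pred R} := [pred x | `[< maxideal_car M x >]].

Lemma maxideal_closed : idealr_closed maxideal_pred.
Proof.
have iM := maxideal_id M; split; first by apply/asboolP; apply: ideal0.
  by apply/asboolP; apply: maxideal_1.
move=> a x y /asboolP Mx /asboolP My; apply/asboolP.
by apply: idealD => //; apply: ideal_mull.
Qed.

HB.instance Definition _ := isIdealr.Build R maxideal_pred maxideal_closed.

Local Notation L := {ideal_quot maxideal_pred}.
Local Open Scope quotient_scope.

Lemma residue_pi_eq0 (x : R) : \pi_L x = 0 <-> maxideal_car M x.
Proof.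
rewrite -(rmorph0 (\pi_L : {rmorphism R -> L})).
by split=> [/eqP|Mx]; [rewrite -Quotient.idealrBE subr0 => /asboolP|apply/eqP;
  rewrite -Quotient.idealrBE subr0; apply/asboolP].
Qed.

Lemma residue_inverse (x : L) : exists y, (x != 0 -> y * x = 1) /\ (x = 0 -> y = 0).
Proof.
have [->|x0] := eqVneq x 0; first by exists 0.
have [|y My] := @maxideal_inv _ M (repr x).
  by move/residue_pi_eq0; rewrite reprK => E; rewrite E eqxx in x0.
exists (\pi_L y); split=> [_|E]; last by rewrite E eqxx in x0.
move/residue_pi_eq0: My.
by rewrite rmorphB rmorph1 rmorphM /= reprK => /eqP; rewrite subr_eq0 => /eqP.
Qed.

Definition residue_inv (x : L) : L := projT1 (cid (residue_inverse x)).

Lemma residue_mulVf x : x != 0 -> residue_inv x * x = 1.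
Proof. by rewrite /residue_inv; case: cid => y H /=; case: H. Qed.

Lemma residue_invr0 : residue_inv 0 = 0.
Proof. by rewrite /residue_inv; case: cid => y H /=; case: H => _; apply. Qed.

HB.instance Definition _ := GRing.ComNzRing_isField.Build L residue_mulVf residue_invr0.

Lemma residue_field : exists (F : fieldType) (phi : {rmorphism R -> F}),
  (forall y, exists x, phi x = y) /\ (forall x, phi x = 0 <-> maxideal_car M x).
Proof.
exists L, (\pi_L : {rmorphism R -> L}); split=> [y|x]; last exact: residue_pi_eq0.
by exists (repr y); rewrite /= reprK.
Qed.

End ResidueField.

(** * Edge order of a generalized tower set *)

Section TowerRank.
Local Open Scope fset_scope.
Local Open Scope nat_scope.
Implicit Types (T S : {fset nat * nat}).

Lemma in_fiber T i j : (i \in fiber T j) = ((i, j) \in T).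
Proof.
apply/imfsetP/idP => [[[a b] /=]|Tij]; last by exists (i, j); rewrite //= !inE Tij eqxx.
by rewrite !inE => /andP[? /eqP<-] ->.
Qed.

Lemma in_pr1 T i j : (i, j) \in T -> i \in pr1 T.
Proof. by move=> Tij; apply/imfsetP; exists (i, j). Qed.

Lemma in_pr2 T i j : (i, j) \in T -> j \in pr2 T.
Proof. by move=> Tij; apply/imfsetP; exists (i, j). Qed.

Lemma pr2P T j : j \in pr2 T -> exists i, (i, j) \in T.
Proof. by case/imfsetP => -[a b] /= Tab ->; exists a. Qed.

Lemma fiber_nonempty T j : j \in pr2 T -> fiber T j != fset0.
Proof. by case/pr2P => i Tij; apply/fset0Pn; exists i; rewrite in_fiber. Qed.

Lemma lex_lt B a c a' c' : c' < B -> a' < a -> a' * B + c' < a * B + c.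
Proof. by nia. Qed.

Lemma lex_le B a c a' c' : c < B -> a' * B + c' <= a * B + c ->
  a' < a \/ a' = a /\ c' <= c.
Proof.
move=> cB le; have [lt|lt|E] := ltngtP a' a; [by left| |by right; split=> //; nia].
by exfalso; nia.
Qed.

Lemma leq_subr_cancel a b c : b <= c -> c - a <= c - b -> b <= a.
Proof. by lia. Qed.

Section Rank.
Variables T S0 : {fset nat * nat}.
Let S := T `|` S0.
Hypotheses (offS : offdiag_pairs S) (connS : connected_set S) (towT : tower_set T).
Hypothesis S0_ends : forall i j : nat, (i, j) \in S0 ->
  i \notin pr1 T `|` pr2 T /\ j \in pr1 T `&` pr2 T.
Hypothesis S0_F : forall i j h : nat, (i, j) \in S0 -> h \in F_ T j -> (i, h) \in S0.

Let posT i j : (i, j) \in T -> 0 < j.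
Proof. by move=> Tij; have [+ _] := towT => /(_ _ _ Tij)[]. Qed.

Let S0_2 i j : (i, j) \in S0 -> j \in pr2 T.
Proof. by case/S0_ends => _; rewrite in_fsetI => /andP[]. Qed.

Let S0_notin i j l : (i, j) \in S0 -> (i, l) \notin T /\ (l, i) \notin T.
Proof.
case/S0_ends => + _; rewrite in_fsetU negb_or => /andP[i1 i2].
by split; [apply: contra i1; apply: in_pr1|apply: contra i2; apply: in_pr2].
Qed.

Let S0_notinT x : x \in S0 -> x \notin T.
Proof. by case: x => i j Sij; case: (S0_notin j Sij). Qed.

Lemma fiber_sub a b : a < b -> a \in pr2 T -> fiber T b `<=` fiber T a.
Proof.
move=> ab a2; have [i /posT a0] := pr2P a2; have [_ sub] := towT.
by apply: sub => //; apply: fiber_nonempty.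
Qed.

Lemma fiber_total a b : a \in pr2 T -> b \in pr2 T ->
  fiber T a `<=` fiber T b \/ fiber T b `<=` fiber T a.
Proof.
move=> a2 b2; have [ab|ba|->] := ltngtP a b; last by left.
  by right; apply: fiber_sub.
by left; apply: fiber_sub.
Qed.

(** As the fibers of the columns in [pr2 T] form a chain, comparing sizes amounts to comparing
    fibers. *)
Let height j := #|` fiber T j|.

Let height_lt a b : a \in pr2 T -> b \in pr2 T -> height a < height b ->
  fiber T a `<` fiber T b.
Proof.
move=> a2 b2 ab; rewrite fproperEcard ab andbT.
by case: (fiber_total a2 b2) => // /fsubset_leq_card; rewrite leqNgt ab.
Qed.

Let height_eq a b : a \in pr2 T -> b \in pr2 T -> height a = height b ->
  fiber T a = fiber T b.
Proof.
move=> a2 b2 ab; have [sub|sub] := fiber_total a2 b2; last apply/esym.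
  by apply/eqP; rewrite eqEfcard sub -/(height b) -ab leqnn.
by apply/eqP; rewrite eqEfcard sub -/(height a) ab leqnn.
Qed.

Let nbrs i c := [fset j in pr2 T | ((i, j) \in S0) && (height j == c)].

Lemma in_nbrs i c j : (j \in nbrs i c) = ((i, j) \in S0) && (height j == c).
Proof.
by rewrite !inE /=; case Sij: ((i, j) \in S0); rewrite ?andbF // (S0_2 Sij).
Qed.

(* Within a class of columns with equal fibers no two columns are adjacent, so
   connectedness (2K_2-freeness) makes the neighbourhoods of the rows nested. *)
Lemma nbrs_nested i p c : i != p -> #|` nbrs i c| <= #|` nbrs p c| ->
  nbrs i c `<=` nbrs p c.
Proof.
move=> ip card; apply: contraT => /fsubsetPn[j jN jP].
have /fsubsetPn[q qP qN] : ~~ (nbrs p c `<=` nbrs i c).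
  apply/negP => sub; have /fproper_ltn_card : nbrs p c `<` nbrs i c.
    by rewrite fproperE sub; apply/fsubsetPn; exists j.
  by rewrite ltnNge card.
move: jN jP qP qN; rewrite !in_nbrs => /andP[Sij jc]; rewrite jc andbT => Spj.
move=> /andP[Spq qc]; rewrite qc andbT => Siq.
have qj : q != j by apply: contraNneq Spj => <-.
have fqj : fiber T q = fiber T j.
  by apply: height_eq; [exact: S0_2 Spq|exact: S0_2 Sij|rewrite (eqP jc) (eqP qc)].
have diag a : (a, a) \notin T.
  apply/negP => Taa; have [_ off] := offS.
  by have := off a a; rewrite in_fsetU Taa eqxx => /(_ isT).
have inS x : x \in S0 -> x \in S by move=> xS; rewrite in_fsetU xS orbT.
have [||C [/imfsetP[[a b] /= Sab ->]]] := connS (A := [fset p; q]) (B := [fset i; j]).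
- by apply/imfsetP; exists (p, q) => //; apply: inS.
- by apply/imfsetP; exists (i, j) => //; apply: inS.
case/fset0Pn => u; rewrite !inE => /andP[u1 u2].
case/fset0Pn => v; rewrite !inE => /andP[v1 v2]; exfalso.
(* A joining edge in [T] avoids the rows [p] and [i], so it joins [q] and [j]; as these have equal
   fibers, one of them would lie in its own fiber. *)
move: Sab; rewrite in_fsetU => /orP[Tab|Sab].
  have [pab iab] : [/\ p != a, p != b, i != a & i != b] /\ True.
    split=> //; split; apply: contraTneq Tab => <-.
    - by case: (S0_notin b Spq).
    - by case: (S0_notin a Spq).
    - by case: (S0_notin b Sij).
    - by case: (S0_notin a Sij).
  have : (q, j) \in T \/ (j, q) \in T.
    case: pab => pa pb ia ib.
    move: u1 u2 v1 v2 => /orP[]/eqP-> ; rewrite ?(negPf pa) ?(negPf pb) //=.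
    by move=> /orP[]/eqP Dq /orP[]/eqP-> ; rewrite ?(negPf ia) ?(negPf ib) //= =>
      /orP[]/eqP Dj; move: qj Tab; rewrite ?Dq ?Dj ?eqxx //; auto.
  case=> H; first by move: (diag q); rewrite -in_fiber fqj in_fiber H.
  by move: (diag j); rewrite -in_fiber -fqj in_fiber H.
(* A joining edge in [S0] runs from a row to a column, so it would be one of the absent edges
   [(p, j)] and [(i, q)], or force [p = i] or [q = j]. *)
have V l : l \in pr2 T -> l != a.
  move=> l2; apply: contraTneq l2 => ->; have [+ _] := S0_ends Sab.
  by rewrite in_fsetU negb_or => /andP[].
have W l l' : (l, l') \in S0 -> l != b.
  move=> Sl; apply: contraTneq (S0_2 Sab) => <-; have [+ _] := S0_ends Sl.
  by rewrite in_fsetU negb_or => /andP[].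
have qa := V q (S0_2 Spq); have ja := V j (S0_2 Sij); have pb := W _ _ Spq; have ib := W _ _ Sij.
have H1 : p = a \/ q = b.
  by move: u1 u2 => /orP[]/eqP->; rewrite ?(negPf pb) ?(negPf qa) ?orbF //= => /eqP; auto.
have H2 : i = a \/ j = b.
  by move: v1 v2 => /orP[]/eqP->; rewrite ?(negPf ib) ?(negPf ja) ?orbF //= => /eqP; auto.
case: H1 H2 => D1 [] D2.
- by rewrite D1 D2 eqxx in ip.
- by rewrite D1 D2 Sab in Spj.
- by rewrite D1 D2 Sab in Siq.
- by rewrite D1 D2 eqxx in qj.
Qed.

Let C := \max_(x <- S) (x.1 + x.2) + #|` pr1 T| + #|` pr2 T|.
Let B := C.+1.
(** A three-digit number in base [B]. Subtraction from [C], a bound for the digits that occur,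
    reverses the order on fiber sizes and neighbour counts; the row breaks the remaining ties. *)
Let key (x : nat * nat) :=
  ((C - height x.2) * B + (C - #|` nbrs x.1 (height x.2)|)) * B + x.1.

(** The offset [B] exceeds every column of [S], so all of [T] precedes [S0]. *)
Definition tower_rank x := if x \in T then x.2 else B + key x.

Let boundS x : x \in S -> x.1 <= C /\ x.2 <= C.
Proof.
move=> xS; have le : x.1 + x.2 <= \max_(y <- S) (y.1 + y.2).
  exact: (@leq_bigmax_seq _ (enum_fset S) xpredT (fun y : nat * nat => y.1 + y.2)).
by rewrite /C; split; rewrite -addnA; apply: leq_trans (leq_addr _ _);
   apply: leq_trans le; rewrite ?leq_addr ?leq_addl.
Qed.

Let height_C j : height j <= C.
Proof.
apply: (@leq_trans #|` pr1 T|); last by rewrite /C; lia.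
by apply/fsubset_leq_card/fsubsetP => i; rewrite in_fiber; apply: in_pr1.
Qed.

Let nbrs_C i c : #|` nbrs i c| <= C.
Proof.
apply: (@leq_trans #|` pr2 T|); last by rewrite /C; lia.
by apply/fsubset_leq_card/fsubsetP => j; rewrite !inE => /andP[].
Qed.

Lemma tower_rankP (i j p q : nat) : (i, j) \in S -> (p, q) \in S ->
  i != p -> i != q -> j != p -> j != q ->
  tower_rank (p, q) <= tower_rank (i, j) ->
  exists w v, [/\ w \in [:: i; j], v \in [:: p; q]
    & ((w, v) \in S /\ tower_rank (w, v) < tower_rank (i, j)) \/
      ((v, w) \in S /\ tower_rank (v, w) < tower_rank (i, j))].
Proof.
have inT x : x \in T -> x \in S by move=> xT; rewrite in_fsetU xT.
have inS0 x : x \in S0 -> x \in S by move=> xS; rewrite in_fsetU xS orbT.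
have rankT x y : x \in T -> y \in S0 -> tower_rank x < tower_rank y.
  move=> xT /S0_notinT yT; rewrite /tower_rank xT (negPf yT).
  by have [] := boundS (inT _ xT); rewrite /B; lia.
have rank_height a b b' : (a, b) \in S0 -> (a, b') \in S0 -> height b < height b' ->
    tower_rank (a, b') < tower_rank (a, b).
  move=> S1 S2 lt; rewrite /tower_rank !(negPf (S0_notinT _)) // ltn_add2l /key /=.
  have [aC _] := boundS (inS0 _ S1); have := height_C b'; have := height_C b => h1 h2.
  by apply: lex_lt; rewrite ?ltnS //; apply: lex_lt; [rewrite ltnS leq_subr|lia].
rewrite in_fsetU => /orP[Tij|Sij]; last first.
  have j2 := S0_2 Sij.
  (* If [(j, q')] is not itself an edge of [T], then [q'] belongs to [F_ T j], and [(i, q')] is in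
     [S0]; it ranks lower because its column has the larger fiber. *)
  have linkF q' : q' \in pr2 T -> q' \in [:: p; q] -> fiber T j `<` fiber T q' ->
    exists w v, [/\ w \in [:: i; j], v \in [:: p; q]
    & ((w, v) \in S /\ tower_rank (w, v) < tower_rank (i, j)) \/
      ((v, w) \in S /\ tower_rank (v, w) < tower_rank (i, j))].
    move=> q2 qpq lt; have [Tjq|Tjq] := boolP ((j, q') \in T).
      exists j, q'; split=> //; rewrite ?in_cons ?eqxx ?orbT //; left.
      by split; [apply: inT|apply: rankT].
    have Siq : (i, q') \in S0 by apply: S0_F Sij _; rewrite !inE /= q2 lt.
    exists i, q'; split=> //; rewrite ?in_cons ?eqxx ?orbT //; left.
    by split; [apply: inS0|apply: rank_height => //; apply: fproper_ltn_card].
  rewrite in_fsetU => /orP[Tpq|Spq] ip iq jp jq le.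
    have [Tpj|Tpj] := boolP ((p, j) \in T).
      exists j, p; split; rewrite ?in_cons ?eqxx ?orbT //; right.
      by split; [apply: inT|apply: rankT].
    apply: (linkF q); [exact: in_pr2 Tpq|by rewrite !inE eqxx orbT|].
    have nsub : ~~ (fiber T q `<=` fiber T j).
      by apply/fsubsetPn; exists p; rewrite in_fiber.
    rewrite fproperE nsub andbT.
    by case: (fiber_total j2 (in_pr2 Tpq)) => // sub; rewrite sub in nsub.
  have q2 := S0_2 Spq; have [iC _] := boundS (inS0 _ Sij).
  have heightC := height_C; have nbrsC := nbrs_C.
  move: le; rewrite {1 2}/tower_rank !(negPf (S0_notinT _)) // leq_add2l /key /=.
  set kp := (X in X * B + p <= _); set ki := (X in _ <= X * B + i) => le.
  have [lek ltk] : kp <= ki /\ (kp < ki \/ p < i).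
    have [|lt|[E le']] := lex_le _ le; first by rewrite ltnS.
      by split; [apply: ltnW|left].
    by split; [apply: eq_leq|right; rewrite ltn_neqAle eq_sym ip].
  have [|lt|[eqh leN]] := lex_le _ lek; first by rewrite ltnS leq_subr.
    apply: (linkF q) => //; first by rewrite !inE eqxx orbT.
    by apply: height_lt => //; move: (heightC j) (heightC q); lia.
  have {}eqh : height q = height j by move: (heightC j) (heightC q); lia.
  (* The columns [q] and [j] have equal fibers, and in their class [p] has at least as many
     neighbours as [i]; nestedness makes [j] one of them. *)
  have Spj : (p, j) \in S0.
    have jN : j \in nbrs i (height j) by rewrite in_nbrs Sij eqxx.
    have /fsubsetP/(_ j jN) : nbrs i (height j) `<=` nbrs p (height j).
      apply: nbrs_nested => //; move: leN (nbrsC i (height j)) (nbrsC p (height j)).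
      by rewrite eqh => le1 le2 _; apply: leq_subr_cancel le2 le1.
    by rewrite in_nbrs => /andP[].
  exists j, p; split; rewrite ?in_cons ?eqxx ?orbT //; right; split; first exact: inS0.
  rewrite /tower_rank !(negPf (S0_notinT _)) // ltn_add2l /key /= -/ki.
  have -> : (C - height j) * B + (C - #|` nbrs p (height j)|) = kp by rewrite /kp eqh.
  case: ltk => [lt|pi]; first by apply: lex_lt => //; have [] := boundS (inS0 _ Spj); rewrite ltnS.
  by apply: (@leq_ltn_trans (ki * B + p)); rewrite ?leq_add2r ?leq_mul2r ?lek ?orbT ?ltn_add2l.
rewrite in_fsetU => /orP[Tpq|Spq] ip iq jp jq; last first.
  by rewrite leqNgt rankT.
(* Both edges are in [T]: [q] is the smaller column, so the tower condition carries row [i] from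
   column [j] to column [q]. *)
rewrite /tower_rank Tpq Tij /= => le; have lt : q < j by rewrite ltn_neqAle eq_sym jq.
have Tiq : (i, q) \in T.
  by have /fsubsetP := fiber_sub lt (in_pr2 Tpq); move=> /(_ i); rewrite !in_fiber; apply.
exists i, q; split; rewrite ?in_cons ?eqxx ?orbT //; left.
by split; [apply: inT|rewrite Tiq].
Qed.

End Rank.
End TowerRank.

(** * Transfer to the quotient *)

Section Pullback.
Variables (R A : comPzRingType) (pi : R -> A).
Hypothesis piD : forall x y, pi (x + y) = pi x + pi y.
Hypothesis piM : forall x y, pi (x * y) = pi x * pi y.
Hypothesis pi1 : pi 1 = 1.
Hypothesis pi_surj : forall y, exists x, pi x = y.
Implicit Types (I J P M : A -> Prop).

Definition pullback J : R -> Prop := fun x => J (pi x).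

Let pi0 : pi 0 = 0.
Proof. by apply: (addrI (pi 0)); rewrite -piD !addr0. Qed.

Let piB x y : pi (x - y) = pi x - pi y.
Proof. by apply: (addIr (pi y)); rewrite -piD !subrK. Qed.

Lemma pullback_ideal J : is_ideal J -> is_ideal (pullback J).
Proof.
move=> iJ; split=> [|x y Jx Jy|a x Jx]; rewrite /pullback.
- by rewrite pi0; apply: ideal0.
- by rewrite piD; apply: idealD.
- by rewrite piM; apply: ideal_mull.
Qed.

Lemma pullback_prime P : prime_ideal P -> prime_ideal (pullback P).
Proof.
move=> [iP P1 primeP]; split; first exact: pullback_ideal.
  by rewrite /pullback pi1.
by move=> x y; rewrite /pullback piM; apply: primeP.
Qed.

Lemma pullback_adj J a : pullback (adj J (pi a)) = adj (pullback J) a.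
Proof.
apply: ideal_ext => x; split=> -[b Jx].
  by have [c Dc] := pi_surj b; exists c; rewrite /pullback piB piM Dc.
by exists (pi b); rewrite -piM -piB.
Qed.

Lemma wreg_pullback J s : wreg (pullback J) s -> wreg J (map pi s).
Proof.
elim: s J => //= a s IH J; rewrite -pullback_adj => -[rega /IH regs]; split=> // y.
by have [x <-] := pi_surj y; rewrite -piM; apply: rega.
Qed.

Lemma noetherian_quotient : noetherian R -> noetherian A.
Proof.
move=> noeR I iI; have [s Is] := noeR _ (pullback_ideal iI).
exists (map pi s) => y; have [x <-] := pi_surj y; split=> [/Is|].
  apply: (gen_ideal_min (pullback_ideal (gen_ideal_is_ideal _))) => a sa.
  by apply: mem_gen_ideal; apply: map_f.
apply: gen_ideal_min => // _ /mapP[a sa ->].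
by apply/(Is a)/mem_gen_ideal.
Qed.

End Pullback.

(** * Primes and parameters over a cover ideal *)

Section CoverQuotient.
Variables (k : fieldType) (n : nat) (X : {set 'I_n * 'I_n}).
Hypothesis neX : forall e, e \in X -> e.1 != e.2.
Local Notation R := {mpoly k[n]}.

(** Otherwise every edge has an end whose variable is outside [P]; the product of these variables is
    in the cover ideal but not in [P]. *)
Lemma prime_over_cover (P : R -> Prop) : prime_ideal P ->
  (forall p, cover_ideal X p -> P p) ->
  exists e, e \in X /\ forall p, vid e p -> P p.
Proof.
move=> primeP XP; have [iP nP1 mulP] := primeP; apply: contrapT => noe.
have ex e : exists v, e \in X -> v \in ends e /\ ~ P 'X_v.
  apply: contrapT => nov; apply: noe; exists e; split.
    by apply: contrapT => neXe; apply: nov; exists e.1.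
  have PX v : v \in ends e -> P 'X_v.
    by move=> ve; apply: contrapT => nPv; apply: nov; exists v.
  move=> p; apply: gen_ideal_min => // x; rewrite !inE => /orP[]/eqP->; apply: PX;
    by rewrite !inE eqxx ?orbT.
have [v vP] := choice ex.
have : P (\prod_(e in X) 'X_(v e)).
  apply: XP => e eX; rewrite (bigD1 e) //=; apply: (ideal_mulr _ (vid_is_ideal _ _)).
  by apply: vid_var; have [] := vP e eX; rewrite in_set2.
apply: (big_ind (fun p => ~ P p)) => // [x y nPx nPy /mulP[]//|e eX].
by have [] := vP e eX.
Qed.

Lemma exists_parameters (M : R -> Prop) : is_ideal M -> ~ M 1 ->
  (forall x, ~ M x -> exists y, M (1 - y * x)) ->
  (forall s, (forall e, e \in X -> wreg (@vid k n e) s) -> wreg (cover_ideal X) s) ->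
  exists s, [/\ wreg (cover_ideal X) s, {in s, forall x, M x} & size s = (n - 2)%N].
Proof.
move=> iM nM1 invM shell; have [L [phi [surj ker]]] := residue_field (Maxideal iM nM1 invM).
pose h := phi \o @mpolyC n k.
have int i : integralOver h (phi 'X_i) by apply: zariski_lemma.
have ex i : exists q, q \is monic /\ M (unipoly i q).
  have [q monq rq] := int i; exists q; split=> //; apply/(ker _).
  by rewrite /unipoly -horner_map -map_poly_comp; apply/eqP.
(* The extra factor ['X] kills the constant coefficient, as [wreg_vid] requires. *)
have [q qP] := choice ex; pose r i := 'X * q i.
have monr i : r i \is monic by rewrite monicMr ?monicX //; case: (qP i).
exists [seq (parameter_poly r)`_l | l <- iota 2 (n - 2)]; split.
- apply: shell => e eX; apply: wreg_vid => //; first exact: neX.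
  by move=> i; rewrite coefXM eqxx.
- move=> _ /mapP[l l_iota ->]; apply: parameter_mem => // [i|].
    rewrite /unipoly rmorphM /= map_polyX hornerM.
    by apply: ideal_mull => //; case: (qP i).
  by move: l_iota; rewrite mem_iota; lia.
- by rewrite size_map size_iota.
Qed.

End CoverQuotient.

Theorem theorem3p19 (S : {fset nat * nat}) (hS : generalized_tower_set S) :
  is_aCM S.
Proof.
move=> k n _; set A := SR_quot k n S.
case: hS => offS connS [T [S0 [DS towT S0_ends S0_F]]].
pose pi (p : {mpoly k[n]}) : A := \pi_(A)%qT p.
have piD x y : pi (x + y) = pi x + pi y by apply: SR_piD.
have piM x y : pi (x * y) = pi x * pi y by rewrite -[LHS]SR_piM.
have pi1 : pi 1 = 1 by [].
have pi_surj y : exists x, pi x = y by exists (repr y); apply: reprK.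
pose X := [set e : 'I_n * 'I_n | (e.1.+1, e.2.+1) \in S].
have neX e : e \in X -> e.1 != e.2.
  by rewrite inE => eS; have [_ /(_ _ _ eS)] := offS.
have pi_ker : pullback pi (@zero_ideal A) = cover_ideal X.
  apply: ideal_ext => p; rewrite /pullback /zero_ideal.
  have -> : (0 : A) = pi 0 by apply/(addrI (pi 0)); rewrite -piD !addr0.
  rewrite SR_piP subr0; split=> [/asboolP Ip [i j]|Xp].
    by rewrite inE; apply: Ip.
  by apply/asboolP => i j Sij; apply: (Xp (i, j)); rewrite inE.
have shell s : (forall e, e \in X -> wreg (@vid k n e) s) -> wreg (cover_ideal X) s.
  move=> wregX; pose rank (e : 'I_n * 'I_n) := tower_rank T S0 (e.1.+1, e.2.+1).
  apply: (wreg_cover (rank := rank)) => // e e'; rewrite !inE => eS e'S dis le.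
  have ne i i' : i \in ends e -> i' \in ends e' -> i.+1 != i'.+1.
    move=> ie i'e'; rewrite eqSS; apply: contraTneq dis => /ord_inj ii'.
    by apply/pred0Pn; exists i; rewrite /= ie ii'.
  have end1 (f : 'I_n * 'I_n) : f.1 \in ends f by rewrite !inE eqxx.
  have end2 (f : 'I_n * 'I_n) : f.2 \in ends f by rewrite !inE eqxx orbT.
  have in_ends (f : 'I_n * 'I_n) w : w \in [:: f.1.+1; f.2.+1] ->
      exists w' : 'I_n, w = w'.+1 /\ w' \in ends f.
    by rewrite !inE => /orP[]/eqP->; [exists f.1|exists f.2].
  rewrite DS in offS connS eS e'S.
  have [||||w [v [/in_ends[w' [-> we]] /in_ends[v' [-> ve]] H]]] :=
    tower_rankP offS connS towT S0_ends S0_F eS e'S _ _ _ _ le; try exact: ne.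
  have j1 : joins (w', v') e e' by exists w', v'; split=> //; left.
  have j2 : joins (v', w') e e' by exists w', v'; split=> //; right.
  by case: H => -[inS lt]; [exists (w', v')|exists (v', w')]; split; rewrite // inE DS.
have noeA : noetherian A by apply: (noetherian_quotient piD piM pi_surj); apply: hilbert_basis.
split=> // M maxM; have primeM := maximal_ideal_prime maxM.
have [iM nM1 _] := maxM; exists (n - 2)%N.
(* Pulled back to the polynomial ring, the lowest prime of the chain contains the ideal of some
   edge, over which [chain_length_le] bounds the length. *)
have chain_le d c : prime_chain M d c -> (d <= n - 2)%N.
  move=> [cprime cstrict _]; pose c' i := pullback pi (c i).
  have primec' i : (i <= d)%N -> prime_ideal (c' i).
    by move=> /cprime; apply: pullback_prime.
  have [|e [eX ec]] := @prime_over_cover k n X (c' 0%N) (primec' 0%N isT).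
    rewrite -pi_ker => p; rewrite /c' /pullback /zero_ideal => ->.
    by apply: ideal0; have [] := cprime 0%N isT.
  apply: (chain_length_le (neX _ eX) primec') => // i id; have [sub [y [cy ncy]]] := cstrict i id.
  split=> [x|]; first exact: sub.
  by have [x Dx] := pi_surj y; exists x; rewrite /c' /pullback Dx.
have chain_of s : wreg (@zero_ideal A) s -> {in s, forall a, M a} ->
    exists c, prime_chain M (size s) c.
  move=> regs Ms; have [|c [cM _]] := wreg_prime_chain noeA (@zero_is_ideal A) primeM _ regs Ms.
    by move=> x ->; apply: ideal0.
  by exists c.
have [||s [regs Ms sizes]] := @exists_parameters k n X neX (pullback pi M) (pullback_ideal piD piM iM) _ _ shell.
- by rewrite /pullback pi1.
- move=> x /(maximal_ideal_inverse maxM)[y My]; have [z Dz] := pi_surj y; exists z.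
  rewrite /pullback; suff -> : pi (1 - z * x) = 1 - y * pi x by [].
  by apply: (addIr (pi (z * x))); rewrite -piD !subrK piM Dz subrK.
have regs' : wreg (@zero_ideal A) (map pi s).
  by apply: (wreg_pullback piD piM pi_surj); rewrite pi_ker.
have Ms' : {in map pi s, forall x, M x} by move=> _ /mapP[x /Ms Mx ->].
(* Depth and codimension are both [n - 2]: the parameters attain the depth, a longer regular
   sequence would give too long a chain, and the chain produced by the parameters attains the
   codimension. *)
split; split.
- exists (map pi s); split; [|exact: Ms'|by rewrite size_map].
  by apply/regular_seq_wreg; split=> // /(gen_ideal_min iM Ms').
- move=> t /regular_seq_wreg[_ regt] Mt; have [c cM] := chain_of t regt Mt.
  exact: chain_le cM.
- by have [c cM] := chain_of _ regs' Ms'; exists c; rewrite -sizes -(size_map pi).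
- exact: chain_le.
Qed.
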